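(* Let $p\ge1$, let $\Xi=\Xi_1\times\cdots\times\Xi_n\subset\mathbb R^d=\mathbb R^{d_1}\times\cdots\times\mathbb R^{d_n}$ with each $\Xi_k\subset\mathbb R^{d_k}$ closed, and let $\bm P_\xi^N$ be the product empirical distribution of samples $\xi^1,\ldots,\xi^N\in\Xi$. Let $P_\xi\in\mathcal P(\Xi)$ and $\bm\varepsilon\succeq0$ be such that $P_\xi\in\mathcal T_p(\bm P_\xi^N,\bm\varepsilon)$, and consider a reference distribution $\widehat P_\xi\in\mathcal P(\Xi)$. (i) If there is a transport plan $\widehat\pi\in\mathcal C(\widehat P_\xi,\bm P_\xi^N)$ such that $\int_{\Xi\times\Xi}\|\eta_k-\zeta_k\|^p\,d\widehat\pi(\eta,\zeta)\le\epsilon_k^p$ holds with some $\epsilon_k\ge0$, for all $k\in\{1,\ldots,n\}$, then $$P_\xi\in\mathcal T_p(\widehat P_\xi,\bm\varepsilon+\bm\epsilon),$$ where $\bm\epsilon:=(\epsilon_1,\ldots,\epsilon_n)$. (ii) If additionally $\widehat P_\xi$ has the product structure $\widehat P_{\xi_1}\otimes\cdots\otimes\widehat P_{\xi_n}$ with $\widehat P_{\xi_k}\in\mathcal P_p(\Xi_k)$, then $P_\xi\in\mathcal T_p(\widehat P_\xi,\bm\varepsilon+\bm\epsilon)$ also holds with $\bm\epsilon:=(\epsilon_1,\ldots,\epsilon_n)$ and $\epsilon_k:=W_p(P_{\xi_k}^N,\widehat P_{\xi_k})$ for all $k\in\{1,\ldots,n\}$.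
   Context: Elements of $\mathbb R^d$ are written $\xi=(\xi_1,\ldots,\xi_n)$ with $\xi_k\in\mathbb R^{d_k}$; each $\mathbb R^{d_k}$ carries an (arbitrary) norm denoted $\|\cdot\|$; $\bm\varepsilon\succeq0$ means all components are nonnegative. $\mathcal P(\cdot)$ denotes Borel probability measures and $\mathcal P_p(\cdot)$ those with finite $p$th moment. The product empirical distribution is $\bm P_\xi^N:=P_{\xi_1}^N\otimes\cdots\otimes P_{\xi_n}^N$, with $P_{\xi_k}^N:=\frac1N\sum_{i=1}^N\delta_{\xi_k^i}$ the empirical distribution of the $k$th components of the samples. $\mathcal C(Q,P)$ is the set of couplings (transport plans): probability measures on the product space with first marginal $Q$ and second marginal $P$. For $P,Q\in\mathcal P_p(\Xi_k)$, $W_p(Q,P):=\big(\inf_{\pi\in\mathcal C(Q,P)}\int\|\zeta_k-\xi_k\|^p\,d\pi(\zeta_k,\xi_k)\big)^{1/p}$. The multi-transport hyperrectangle is $$\mathcal T_p(Q,\bm\varepsilon):=\Big\{\mathrm{pr}_{2\#}\pi:\ \pi\in\mathcal P(\Xi\times\Xi),\ \mathrm{pr}_{1\#}\pi=Q,\ \int_{\Xi\times\Xi}\|\zeta_k-\xi_k\|^p\,d\pi(\zeta,\xi)\le\varepsilon_k^p\ \text{for all }k\in\{1,\ldots,n\}\Big\},$$ where $\mathrm{pr}_{1\#}\pi,\mathrm{pr}_{2\#}\pi$ are the first and second marginals of $\pi$. *)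

(* Defs.v *)
From HB Require Import structures.
From mathcomp Require Import all_boot all_order all_algebra.
From mathcomp Require Import all_classical all_reals all_analysis.
From mathcomp Require Import measurable_realfun.

Set Implicit Arguments.
Unset Strict Implicit.
Unset Printing Implicit Defensive.
Import Order.TTheory GRing.Theory Num.Theory numFieldNormedType.Exports.

Local Open Scope classical_set_scope.
Local Open Scope ring_scope.

(* R^m with its Borel sigma-algebra; this is an alias of 'rV[R]_m. Products
   euclid R m * euclid R m' carry the product sigma-algebra, which is the Borel
   one since these spaces are second countable. *)
Definition euclid (R : realType) (m : nat) :=
  g_sigma_algebraType (@open 'rV[R]_m).

(* An element of R^d with d = d_1 + ... + d_n is a row vector made of n
   consecutive blocks; [block x k] is its k-th component in R^{d_k}. *)
Definition block (R : realType) (n : nat) (d : 'I_n -> nat)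
    (x : 'rV[R]_(\sum_k d k)) (k : 'I_n) : 'rV[R]_(d k) :=
  submxrow x k.

Record is_norm (R : realType) (m : nat) (N : 'rV[R]_m -> R) : Prop := {
  is_norm_triangle : forall x y, N (x + y) <= N x + N y ;
  is_norm_homogeneous : forall (a : R) x, N (a *: x) = `|a| * N x ;
  is_norm_definite : forall x, N x = 0 -> x = 0 }.

Section borel_measurability.
Context (R : realType) d (T : measurableType d).

Lemma measurable_euclidP m (f : T -> 'rV[R]_m) :
  (forall j, measurable_fun [set: T] (fun t => f t ord0 j)) ->
  measurable_fun [set: T] (f : T -> euclid R m).
Proof.
move=> mf.
apply: (@measurability _ _ T (euclid R m) setT f (@open 'rV[R]_m)) => //.
move=> _ [U oU <-]; rewrite setTI.
pose B (p : 'rV[rat]_m * nat) : set 'rV[R]_m :=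
  [set y | forall j, `|ratr (p.1 ord0 j) - y ord0 j| < p.2.+1%:R^-1].
have -> : f @^-1` U =
    \bigcup_(p in [set p | B p `<=` U]) f @^-1` (B p).
  apply/seteqP; split => [t /= Uft|t [p /= pU Bpt]]; last exact: pU.
  have /nbhs_ballP[e /= e0 eU] : nbhs (f t) U by exact: open_nbhs_nbhs.
  have [N Ne] : exists N : nat, N.+1%:R^-1 < e / 2.
    have e2 : 0 < e / 2 by rewrite divr_gt0.
    have [N _ /(_ N (leqnn N)) /=] := near_infty_natSinv_lt (PosNum e2).
    by exists N.
  have /choice[q Hq] : forall j, exists q : rat,
      `|ratr q - f t ord0 j| < N.+1%:R^-1.
    move=> j; have /rat_in_itvoo[q] :
        f t ord0 j - N.+1%:R^-1 < f t ord0 j + N.+1%:R^-1 :> R.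
      by rewrite ltrBlDr -addrA ltrDl addr_gt0 // invr_gt0 ltr0n.
    rewrite in_itv/= => Hq.
    by exists q; rewrite ltr_distl.
  exists (\row_j q j, N) => /=; last by move=> j; rewrite mxE.
  move=> y /= By; apply: eU; rewrite /ball /=; split => // i j.
  rewrite /ball /= (ord1 i) [e]splitr.
  apply: (le_lt_trans (ler_distD (ratr (q j)) _ _)).
  by rewrite ltrD // (lt_trans _ Ne)//;
    [rewrite distrC|have := By j; rewrite mxE].
rewrite bigcup_mkcond; apply: countable_bigcupT_measurable => [|p].
  exact: countableP.
case: ifP => // _.
have -> : f @^-1` B p = \bigcap_(j in [set: 'I_m])
    ((fun t => f t ord0 j) @^-1`
       [set z | `|ratr (p.1 ord0 j) - z| < p.2.+1%:R^-1]).
  by apply/seteqP; split => [t /= Bt j _|t /= Bt j]; apply: Bt.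
apply: fin_bigcap_measurable => // j _.
have := mf j measurableT; rewrite /measurable_fun => mfj.
rewrite -[X in measurable X]setTI; apply: mfj.
apply: open_measurable.
exact: (ball_open (ratr (p.1 ord0 j) : R) (p.2.+1%:R^-1)).
Qed.


Lemma measurable_euclid_continuous m m' (f : 'rV[R]_m -> 'rV[R]_m') :
  continuous f ->
  measurable_fun [set: euclid R m] (f : euclid R m -> euclid R m').
Proof.
move=> /continuousP cf.
apply: (@measurability _ _ (euclid R m) (euclid R m') setT f (@open _)) => //.
move=> _ [U oU <-]; rewrite setTI; apply: sub_sigma_algebra; exact: cf.
Qed.

Lemma measurable_euclid_coord m (j : 'I_m) :
  measurable_fun [set: euclid R m] (fun x : 'rV[R]_m => x ord0 j).
Proof.
apply: (measurability _ (RGenOpens.measurableE R)) => //.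
move=> _ [_ [a [b ->]] <-]; rewrite setTI; apply: sub_sigma_algebra.
have /continuousP := @coord_continuous R 1 m ord0 j; apply.
exact: interval_open.
Qed.

End borel_measurability.

Section product_probability.
Context (R : realType) (n : nat) (d : 'I_n -> nat).
Local Notation D := (\sum_k d k)%N.

Lemma measurable_block k :
  measurable_fun [set: euclid R D] ((fun x => block x k) : euclid R D -> euclid R (d k)).
Proof.
apply: measurable_euclidP => j; apply: (eq_measurable_fun
  (fun x : euclid R D => x ord0 (tagnat.Rank k j))).
  by move=> x _; rewrite /block mxE.
exact: measurable_euclid_coord.
Qed.

Definition set_block (k : 'I_n) (yx : euclid R (d k) * euclid R D) :
    euclid R D :=
  \mxrow_j dfwith (block yx.2) k yx.1 j.

Lemma block_set_block k yx j :
  block (set_block (k := k) yx) j = dfwith (block yx.2) k yx.1 j.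
Proof. by rewrite /block /set_block mxrowK. Qed.

Lemma measurable_set_block k : measurable_fun setT (@set_block k).
Proof.
apply: measurable_euclidP => s; apply: (eq_measurable_fun
  (fun yx : euclid R (d k) * euclid R D =>
   dfwith (block yx.2) k yx.1 (tagnat.sig1 s) ord0 (tagnat.sig2 s))).
  by move=> yx _; rewrite /set_block mxE.
move: (tagnat.sig1 s) (tagnat.sig2 s) => j i.
have [kj|kj] := eqVneq k j.
  subst j; apply: (eq_measurable_fun
    (fun yx : euclid R (d k) * euclid R D => (yx.1 : 'rV_(d k)) ord0 i)).
    by move=> yx _; rewrite dfwithin.
  apply: measurableT_comp (measurable_euclid_coord _) _.
  exact: measurable_fst.
apply: (eq_measurable_fun (fun yx : euclid R (d k) * euclid R D =>
    (yx.2 : 'rV_D) ord0 (tagnat.Rank j i))).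
  by move=> yx _; rewrite dfwithout// /block mxE.
apply: measurableT_comp (measurable_euclid_coord _) _.
exact: measurable_snd.
Qed.

HB.instance Definition _ k := isMeasurableFun.Build _ _ _ _
  (@set_block k) (@measurable_set_block k).

Variable P : forall k, probability (euclid R (d k)) R.

(* The law of a vector whose blocks indexed by [s] are independent with laws
   [P k] and whose other blocks are 0. *)
Fixpoint block_product (s : seq 'I_n) : probability (euclid R D) R :=
  if s is k :: s' then
    distribution (P k \x block_product s')%E (@set_block k)
  else \d_(0 : euclid R D).

Definition product_prob : probability (euclid R D) R :=
  block_product (enum 'I_n).

Lemma measurable_blocks (s : seq 'I_n) (A : forall k, set (euclid R (d k))) :
  (forall k, measurable (A k)) ->
  measurable [set x : euclid R D | forall k, k \in s -> A k (block x k)].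
Proof.
move=> mA; rewrite [X in measurable X](_ : _ =
    \bigcap_(k in [set k | k \in s]) (fun x => block x k) @^-1` A k).
  apply: fin_bigcap_measurable => // k _.
  by rewrite -[X in measurable X]setTI; exact: measurable_block.
by apply/seteqP; split => x /= xA k; apply: xA.
Qed.

Lemma product_probE (A : forall k, set (euclid R (d k))) :
  (forall k, measurable (A k)) ->
  product_prob [set x | forall k, A k (block x k)] = (\prod_k P k (A k))%E.
Proof.
move=> mA; suff H (s : seq 'I_n) : uniq s ->
    block_product s [set x | forall k, k \in s -> A k (block x k)] =
    (\prod_(k <- s) P k (A k))%E.
  rewrite -[RHS]big_enum/= -H ?enum_uniq//; congr (block_product _ _).
  by apply/seteqP; split => x /= xA k; [move=> _|]; apply: xA;
    rewrite ?mem_enum.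
elim: s => [_|k s IH /= /andP[ks us]].
  by rewrite big_nil /= diracE mem_set.
rewrite big_cons -IH// /distribution /pushforward /=.
rewrite -product_measure1E; [|exact: mA|exact: measurable_blocks].
congr product_measure1; apply/seteqP; split => -[y x] /=.
  move=> H; split => [|j js].
    by have := H k; rewrite mem_head block_set_block dfwithin; apply.
  have := H j; rewrite inE js orbT block_set_block dfwithout.
    by apply.
  by apply: contraNneq ks => ->.
move=> [yA xA] j; rewrite inE block_set_block => /predU1P[->|js].
  by rewrite dfwithin.
by rewrite dfwithout; [exact: xA|apply: contraNneq ks => ->].
Qed.

End product_probability.

Section empirical.
Context dd (T : measurableType dd) (R : realType) (N : nat).
Variable x : 'I_N.+1 -> T.

(* There are N.+1 samples, so that the sample size is positive. *)
Definition empirical : set T -> \bar R :=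
  mscale (N.+1%:R^-1)%:nng (msum (fun i => \d_(x (inord i))) N.+1).

HB.instance Definition _ := Measure.on empirical.

Let empirical_setT : empirical setT = 1%E.
Proof.
rewrite /empirical /mscale/= /msum (eq_bigr (fun=> 1%E)); last first.
  by move=> i _; exact: diracT.
by rewrite sumEFin big_const_ord iter_addr_0 -EFinM mulVf.
Qed.

HB.instance Definition _ :=
  Measure_isProbability.Build _ _ _ empirical empirical_setT.

Lemma empiricalE A :
  empirical A = (N.+1%:R^-1%:E * \sum_(i < N.+1) \d_(x i) A)%E.
Proof.
rewrite /empirical /mscale/= /msum; congr (_ * _)%E.
by apply: eq_bigr => i _; rewrite inord_val.
Qed.

End empirical.

Definition product_empirical (R : realType) (n : nat) (d : 'I_n -> nat)
    (N : nat) (xi : 'I_N.+1 -> 'rV[R]_(\sum_k d k)) :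
    probability (euclid R (\sum_k d k)) R :=
  product_prob (fun k =>
    empirical R (fun i => block (xi i) k : euclid R (d k))).

(* Measures are set functions whose values on non-measurable sets are
   irrelevant, hence equality of measures is equality on measurable sets. *)
Definition same_measure dd (T : measurableType dd) (R : realType)
    (mu nu : set T -> \bar R) : Prop :=
  forall A, measurable A -> mu A = nu A.

Definition coupling d1 d2 (T1 : measurableType d1) (T2 : measurableType d2)
    (R : realType) (Q : probability T1 R) (P : probability T2 R) :
    set (probability (T1 * T2)%type R) :=
  [set pi | same_measure (pushforward pi fst) Q /\
            same_measure (pushforward pi snd) P].

(* A probability measure on a measurable subset Xi of T is encoded as a
   probability measure on T that gives mass 1 to Xi. *)
Definition prob_on dd (T : measurableType dd) (R : realType) (Xi : set T) :
    set (probability T R) :=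
  [set P | P Xi = 1%E].

Definition prob_moment_on (R : realType) (m : nat) (N : 'rV[R]_m -> R) (p : R)
    (Xi : set (euclid R m)) : set (probability (euclid R m) R) :=
  [set P | prob_on Xi P /\
           (\int[P]_x (N x `^ p)%:E < +oo)%E].

Definition wasserstein (R : realType) (m : nat) (N : 'rV[R]_m -> R) (p : R)
    (Q P : probability (euclid R m) R) : \bar R :=
  poweR (ereal_inf [set (\int[pi]_z (N (z.1 - z.2) `^ p)%:E)%E
                   | pi in coupling Q P]) p^-1.

Definition product_set (R : realType) (n : nat) (d : 'I_n -> nat)
    (Xi : forall k, set 'rV[R]_(d k)) : set (euclid R (\sum_k d k)) :=
  [set x | forall k, Xi k (block x k)].

Definition transport_hyperrectangle (R : realType) (n : nat) (d : 'I_n -> nat)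
    (N : forall k, 'rV[R]_(d k) -> R) (p : R) (Xi : set (euclid R (\sum_k d k)))
    (Q : probability (euclid R (\sum_k d k)) R) (eps : 'I_n -> R) :
    set (probability (euclid R (\sum_k d k)) R) :=
  [set P | exists pi : probability
                         (euclid R (\sum_k d k) * euclid R (\sum_k d k))%type R,
    [/\ prob_on (Xi `*` Xi) pi,
        same_measure (pushforward pi fst) Q,
        same_measure (pushforward pi snd) P &
        forall k, (\int[pi]_(z in Xi `*` Xi)
                     (N k (block z.1 k - block z.2 k) `^ p)%:E
                   <= (eps k `^ p)%:E)%E]].

(* Main.v *)
From HB Require Import structures.
Require Import Defs.
From mathcomp Require Import all_boot all_order all_algebra.
From mathcomp Require Import all_classical all_reals all_analysis.
From mathcomp Require Import measurable_realfun ring lra.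

Set Implicit Arguments.
Unset Strict Implicit.
Unset Printing Implicit Defensive.
Import Order.TTheory GRing.Theory Num.Theory numFieldNormedType.Exports.

Local Open Scope classical_set_scope.
Local Open Scope ring_scope.
(* The product empirical distribution is uniform on the grid of points whose
   k-th block is the k-th block of some sample, counted with multiplicity. A plan
   between such a finite uniform measure and a measure mu amounts to a partition
   of unity (f_s) made of mu-densities of equal mass. Two plans, with densities
   f_s on Q and g_s on P, are glued along the grid by the density
   |S| * sum_s f_s(x) g_s(y) with respect to Q * P, and the cost of the result is
   bounded by Minkowski's inequality; this gives (i).

   For (ii), densities f_{k,i} of optimal plans between the k-th marginals give
   the densities prod_k f_{k, s k}(x_k), indexed by the grid points s. Exactly
   optimal plans are needed: densities of almost optimal plans form convex sets,
   and almost minimizers of the L^2 norm on these sets form, by the parallelogram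
   identity, a Cauchy sequence that converges almost everywhere to an optimal
   plan. *)

Local Open Scope ereal_scope.

(** * Probability measures given by a density *)

Section density_measure.
Context dd (T : measurableType dd) (R : realType) (mu : probability T R).

(** The proofs about [f] are arguments so that the probability structure can be inferred from the
    term itself. *)
Definition density_measure (f : T -> \bar R) (mf : measurable_fun setT f)
    (f0 : forall x, 0 <= f x) (f1 : \int[mu]_x f x = 1) (A : set T) : \bar R :=
  \int[mu]_(x in A) f x.

Context (f : T -> \bar R) (mf : measurable_fun setT f)
  (f0 : forall x, 0 <= f x) (f1 : \int[mu]_x f x = 1).

Local Notation nu := (density_measure mf f0 f1).

Let nu0 : nu set0 = 0. Proof. exact: integral_set0. Qed.

Let nu_ge0 A : 0 <= nu A. Proof. exact: integral_ge0. Qed.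

Let nu_additive : semi_sigma_additive nu.
Proof. exact: semi_sigma_additive_nng_induced. Qed.

HB.instance Definition _ :=
  isMeasure.Build _ _ _ nu nu0 nu_ge0 nu_additive.

HB.instance Definition _ := Measure_isProbability.Build _ _ _ nu f1.

(** [f] and the Radon-Nikodym derivative of [nu] have the same integral over every measurable set,
    hence agree almost everywhere, and the change of variables formula for the derivative
    applies. *)
Lemma integral_density (g : T -> \bar R) :
  measurable_fun setT g -> (forall x, 0 <= g x) ->
  \int[nu]_x g x = \int[mu]_x (g x * f x).
Proof.
move=> mg g0.
have numu : nu `<< mu.
  apply/null_content_dominatesP => A mA muA.
  apply: null_set_integral => //; exact: measurable_funTS.
rewrite -(Radon_Nikodym_SigmaFinite.change_of_variables numu)//.
apply: ge0_ae_eq_integral => //.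
- apply: emeasurable_funM => //.
  exact: measurable_int (Radon_Nikodym_SigmaFinite.f_integrable numu).
- exact: emeasurable_funM.
- by move=> x _; rewrite mule_ge0// Radon_Nikodym_SigmaFinite.f_ge0.
- by move=> x _; rewrite mule_ge0.
apply: ae_eqe_mul2l; apply: integral_ae_eq => //.
- exact: Radon_Nikodym_SigmaFinite.f_integrable.
- by move=> A _ mA; rewrite -Radon_Nikodym_SigmaFinite.f_integral.
Qed.

End density_measure.

(** The complement of [D] is negligible. This removes the restriction of transport costs to the
    product of the supports. *)
Lemma integral_full_set dd (T : measurableType dd) (R : realType)
    (mu : probability T R) (D : set T) (f : T -> \bar R) :
  measurable D -> mu D = 1 -> measurable_fun setT f -> (forall x, 0 <= f x) ->
  \int[mu]_(x in D) f x = \int[mu]_x f x.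
Proof.
move=> mD muD mf f0.
have muDC : mu (~` D) = 0 by rewrite probability_setC// muD subee.
rewrite [RHS](@ge0_negligible_integral _ _ _ _ setT (~` D))//.
- by rewrite setTD setCK.
- exact: measurableC.
Qed.

(** * Plans between a finite uniform measure and an arbitrary one *)

(* Indexing [mu]-densities by the atoms of a uniform measure over [S] encodes
   a plan between that measure and [mu]. *)
Record plan_density dd (T : measurableType dd) (R : realType)
    (mu : probability T R) (S : finType) (f : S -> T -> R) : Prop := {
  plan_density_measurable : forall s, measurable_fun setT (f s) ;
  plan_density_ge0 : forall s x, (0 <= f s x)%R ;
  plan_density_sum : forall x, (\sum_s f s x)%R = 1%R ;
  plan_density_mass : forall s,
    \int[mu]_x (f s x)%:E = (#|S|%:R^-1)%:E }.

(** This describes the image under [y] of the uniform measure on [S]. Samples may coincide, so a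
    point is charged in proportion to the number of indices that reach it. *)
Definition uniform_atoms dd (T : measurableType dd) (R : realType)
    (Q : set T -> \bar R) (S : finType) (y : S -> T) : Prop :=
  forall s, Q [set y s] =
    (#|[pred t | y t == y s]|%:R / #|S|%:R)%:E.

(** Radon-Nikodym derivatives sum to 1 only almost everywhere, while [plan_density] asks for it at
    every point. On the exceptional null set the family is replaced by the constant 1/|S|; [s0]
    ensures that these constants sum to 1. *)
Lemma plan_density_modify dd (T : measurableType dd) (R : realType)
    (mu : probability T R) (S : finType) (s0 : S) (h : S -> T -> R) :
  (forall s, measurable_fun setT (h s)) ->
  (forall s x, (0 <= h s x)%R) ->
  {ae mu, forall x, (\sum_s h s x)%R = 1%R} ->
  (forall s, \int[mu]_x (h s x)%:E = (#|S|%:R^-1)%:E) ->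
  exists2 f, plan_density mu f &
    forall s, ae_eq mu setT (EFin \o f s) (EFin \o h s).
Proof.
move=> mh h0 h1 hI.
have S0 : (#|S|%:R : R) != 0%R.
  by rewrite pnatr_eq0 -lt0n; apply/card_gt0P; exists s0.
pose f s x : R := if (\sum_t h t x)%R == 1%R then h s x else (#|S|%:R^-1)%R.
have fh s : ae_eq mu setT (EFin \o f s) (EFin \o h s).
  by apply: filterS h1 => x hx1 _; rewrite /= /f hx1 eqxx.
have mf s : measurable_fun setT (f s).
  apply: measurable_fun_ifT => //.
  apply: measurable_fun_eqr => //.
  exact: measurable_sum.
have f0 s x : (0 <= f s x)%R by rewrite /f; case: ifP.
exists f; last exact: fh.
split => //.
  move=> x; have [e|ne] := eqVneq (\sum_t h t x)%R 1%R.
    by rewrite -[RHS]e; apply: eq_bigr => s _; rewrite /f e eqxx.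
  rewrite (eq_bigr (fun=> #|S|%:R^-1)%R) => [|s _]; last by rewrite /f (negbTE ne).
  by rewrite sumr_const -[X in X = _]mulr_natl mulfV.
move=> s; rewrite -(hI s); apply: ge0_ae_eq_integral => //.
- exact/measurable_EFinP.
- exact/measurable_EFinP.
- by move=> x _; rewrite lee_fin.
- by move=> x _; rewrite lee_fin.
exact: fh.
Qed.

(** * Disintegration of a plan over finitely many atoms *)

Section plan_disintegration.
Context d0 d1 d2 (T0 : measurableType d0) (T1 : measurableType d1)
  (T2 : measurableType d2) (R : realType).
Context (pi : probability T0 R) (mu : probability T2 R).
Context (a : T0 -> T1) (b : T0 -> T2).
Hypotheses (ma : measurable_fun setT a) (mb : measurable_fun setT b).
Hypothesis pimu : same_measure (pushforward pi b) mu.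
Context (S : finType) (y : S -> T1) (s0 : S).
Hypothesis my : forall s, measurable [set y s].
Hypothesis piy : uniform_atoms (pushforward pi a) y.

Let c s : R := #|[pred t | y t == y s]|%:R%R.

Let c_gt0 s : (0 < c s)%R.
Proof. by rewrite ltr0n; apply/card_gt0P; exists s; rewrite inE/=. Qed.

Let S_gt0 : (0 < #|S|%:R :> R)%R.
Proof. by rewrite ltr0n; apply/card_gt0P; exists s0. Qed.

Let D s := a @^-1` [set y s].

Let mD s : measurable (D s).
Proof. by rewrite -[D s]setTI; exact: ma. Qed.

(** Thanks to the division by the multiplicity, the weights of all the indices of one atom add up to
    1 on the event that [a] hits this atom. *)
Let w s (z : T0) : R := ((c s)^-1 * \1_(D s) z)%R.

Let w_ge0 s z : (0 <= w s z)%R.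
Proof. by rewrite mulr_ge0// invr_ge0 ltW. Qed.

Let mw s : measurable_fun setT (w s).
Proof. exact: measurable_funM. Qed.

Let U := \bigcup_(s in [set: S]) D s.

Let mU : measurable U.
Proof. by apply: fin_bigcup_measurable. Qed.

Let sum_w z : (\sum_s w s z)%R = \1_U z :> R.
Proof.
have [[s _ Dsz]|nUz] := pselect (U z); last first.
  rewrite big1 ?indicE ?memNset// => s _; rewrite /w indicE memNset ?mulr0//.
  by move=> Dsz; apply: nUz; exists s.
rewrite [RHS]indicE mem_set; last by exists s.
rewrite (bigID [pred t | y t == y s])/= [X in (_ + X)%R]big1 ?addr0; last first.
  move=> t yts; rewrite /w indicE memNset ?mulr0// => Dtz.
  by move/eqP : yts; apply; rewrite -Dsz -Dtz.
rewrite (eq_bigr (fun=> (c s)^-1)%R) => [|t /eqP yts]; last first.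
  rewrite /w /D /c yts indicE mem_set ?mulr1//.
by rewrite sumr_const -[X in X = _]mulr_natl mulfV// gt_eqF// c_gt0.
Qed.

Let int_w s : \int[pi]_z (w s z)%:E = (#|S|%:R^-1)%:E.
Proof.
under eq_integral do rewrite EFinM.
rewrite ge0_integralZl_EFin//; last 2 first.
- exact/measurable_EFinP.
- by rewrite invr_ge0 ltW.
rewrite integral_indic// setIT [X in _ * X](piy s).
by rewrite -EFinM mulrA mulVf ?mul1r// gt_eqF.
Qed.

(** The weights sum to the indicator of [U], and each of them has integral 1/|S|. *)
Let piU : pi U = 1.
Proof.
rewrite -[U]setIT -integral_indic//.
under eq_integral do rewrite -sum_w -sumEFin.
rewrite ge0_integral_sum//; last first.
- by move=> s z _; rewrite lee_fin.
- by move=> s; exact/measurable_EFinP.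
rewrite (eq_bigr (fun=> (#|S|%:R^-1)%:E)) => [|s _]; last exact: int_w.
by rewrite sumEFin sumr_const -[X in X%:E = _]mulr_natl mulfV ?gt_eqF.
Qed.

Let integral_weights (g : T0 -> \bar R) :
  measurable_fun setT g -> (forall z, 0 <= g z) ->
  \int[pi]_z g z = \sum_s \int[pi]_z (g z * (w s z)%:E).
Proof.
move=> mg g0; rewrite -(integral_full_set mU piU mg g0).
rewrite -ge0_integral_sum//; last first.
- by move=> s z _; rewrite mule_ge0// lee_fin.
- by move=> s; apply: emeasurable_funM => //; exact/measurable_EFinP.
rewrite [LHS]integral_mkcond; apply: eq_integral => z _.
rewrite -ge0_sume_distrr; last by move=> s _; rewrite lee_fin.
by rewrite sumEFin sum_w epatch_indic.
Qed.

Let q_def s (z : T0) : \bar R := (#|S|%:R * w s z)%:E.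

Let mq s : measurable_fun setT (q_def s).
Proof. by apply/measurable_EFinP; exact: measurable_funM. Qed.

Let q_ge0 s z : 0 <= q_def s z.
Proof. by rewrite lee_fin mulr_ge0. Qed.

Let int_q s : \int[pi]_z q_def s z = 1.
Proof.
under eq_integral do rewrite /q_def EFinM.
rewrite ge0_integralZl_EFin//; last 2 first.
- by move=> z _; rewrite lee_fin.
- exact/measurable_EFinP.
by rewrite int_w -EFinM mulfV// gt_eqF.
Qed.

(** This is [pi] conditioned on the event [a = y s], and [nu s] below is the conditional law of
    [b]. *)
Let q s : probability T0 R := density_measure (mq s) (q_ge0 s) (int_q s).

Let bmfun : {mfun T0 >-> T2} := HB.pack b (isMeasurableFun.Build _ _ _ _ b mb).

Let nu s : probability T2 R := distribution (q s) bmfun.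

Let nu_mu s : nu s `<< mu.
Proof.
apply/null_content_dominatesP => A mA muA.
apply: null_set_integral => //=.
- by rewrite -[_ @^-1` _]setTI; exact: mb.
- by apply: measurable_funTS; exact: mq.
- by rewrite -muA; exact: pimu.
Qed.

Let r s := Radon_Nikodym_SigmaFinite.f (nu s) mu.

Let r_ge0 s x : 0 <= r s x.
Proof. exact: (Radon_Nikodym_SigmaFinite.f_ge0 (@nu_mu _)). Qed.

Let r_fin s x : r s x \is a fin_num.
Proof. exact: (Radon_Nikodym_SigmaFinite.f_fin_num (@nu_mu _)). Qed.

Let r_int s : mu.-integrable setT (r s).
Proof. exact: (Radon_Nikodym_SigmaFinite.f_integrable (@nu_mu _)). Qed.

Let mr s : measurable_fun setT (r s).
Proof. exact: measurable_int (r_int s). Qed.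

Let h s x : R := (#|S|%:R^-1 * fine (r s x))%R.

Let h_ge0 s x : (0 <= h s x)%R.
Proof. by rewrite mulr_ge0// fine_ge0. Qed.

Let mh s : measurable_fun setT (h s).
Proof. by apply: measurable_funM => //; exact: measurableT_comp. Qed.

(** The measure with [mu]-density [h s] is the image under [b] of the piece of [pi] weighted by
    [w s], because [h s] is the derivative of [nu s] rescaled to mass 1/|S|. *)
Let int_h (g : T2 -> \bar R) s : measurable_fun setT g ->
  (forall x, 0 <= g x) ->
  \int[mu]_x (g x * (h s x)%:E) = \int[pi]_z (g (b z) * (w s z)%:E).
Proof.
move=> mg g0.
under eq_integral do rewrite /h EFinM fineK// muleCA.
rewrite ge0_integralZl_EFin//; last 2 first.
- by move=> x _; rewrite mule_ge0.
- exact: emeasurable_funM.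
rewrite (Radon_Nikodym_SigmaFinite.change_of_variables (@nu_mu s))//.
rewrite ge0_integral_pushforward//=.
rewrite preimage_setT integral_density//=; last exact: measurableT_comp.
under eq_integral do rewrite /q_def EFinM muleCA.
rewrite ge0_integralZl_EFin//; last 2 first.
- by move=> x _; rewrite mule_ge0// lee_fin.
- by apply: emeasurable_funM => //; [exact: measurableT_comp|exact/measurable_EFinP].
by rewrite muleA -EFinM mulVf ?mul1e// gt_eqF.
Qed.

(* [f s] is the Radon-Nikodym derivative of the law of [b] on the event
   [a = y s], divided by the multiplicity of [y s] so that repeated atoms share
   their mass equally. *)
Lemma plan_disintegration : exists2 f, plan_density mu f &
  forall G : T1 * T2 -> \bar R, measurable_fun setT G ->
    (forall z, 0 <= G z) ->
    \int[pi]_z G (a z, b z) = \sum_s \int[mu]_x (G (y s, x) * (f s x)%:E).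
Proof.
have [||f pf fh] := @plan_density_modify _ _ _ mu _ s0 h mh h_ge0.
(* The sum of the [h s] is compared with 1 through integrals over an arbitrary [A]: adding up the
   pieces gives the [pi]-mass of the preimage of [A] under [b], which is [mu A]. *)
- suff : ae_eq mu setT (cst 1) (fun x => \sum_s (h s x)%:E).
    apply: filterS => x /(_ I); rewrite sumEFin => -[<-//].
  apply: integral_ae_eq => //.
  + exact: finite_measure_integrable_cst.
  + by apply: emeasurable_sum => s; exact/measurable_EFinP.
  move=> A _ mA; rewrite integral_cst// mul1e.
  rewrite [RHS]integral_mkcond.
  transitivity (\int[mu]_x \sum_s ((\1_A x)%:E * (h s x)%:E)); last first.
    apply: eq_integral => x _; rewrite epatch_indic muleC.
    by rewrite ge0_sume_distrr// => s _; rewrite lee_fin.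
  rewrite ge0_integral_sum//; last first.
  + by move=> s x _; rewrite mule_ge0// lee_fin.
  + by move=> s; apply: emeasurable_funM; exact/measurable_EFinP.
  under [RHS]eq_bigr => s _.
    rewrite (int_h (g := fun x => (\1_A x)%:E))//; last first.
      exact/measurable_EFinP.
    over.
  rewrite -integral_weights; last first.
  + by move=> z; rewrite lee_fin.
  + by apply/measurable_EFinP; apply: measurableT_comp.
  have mbA : measurable (b @^-1` A) by rewrite -[_ @^-1` _]setTI; exact: mb.
  rewrite [RHS](integral_indic _ measurableT mbA) setIT.
  exact/esym/pimu.
- move=> s; under eq_integral do rewrite -[(h _ _)%:E]mul1e.
  rewrite (int_h (g := cst 1))//=.
  by under eq_integral do rewrite mul1e; rewrite int_w.
exists f => // G mG G0.
have mGy s : measurable_fun setT (fun x => G (y s, x)).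
  exact: measurableT_comp.
rewrite integral_weights//; last first.
  by apply: measurableT_comp => //; exact: measurable_fun_pair.
apply: eq_bigr => s _.
transitivity (\int[mu]_x (G (y s, x) * (h s x)%:E)).
  rewrite int_h//; apply: eq_integral => z _.
  (* On [D s] the value of [a] is [y s]; off it the weight vanishes. *)
  have [Dz|nDz] := pselect (D s z); first by rewrite /= Dz.
  by rewrite /w indicE memNset// mulr0 !mule0.
apply: ge0_ae_eq_integral => //.
- by apply: emeasurable_funM => //; exact/measurable_EFinP.
- apply: emeasurable_funM => //; apply/measurable_EFinP.
  exact: plan_density_measurable pf _.
- by move=> x _; rewrite mule_ge0// lee_fin.
- by move=> x _; rewrite mule_ge0// lee_fin (plan_density_ge0 pf).
- by apply: ae_eqe_mul2l; apply: ae_eq_sym; exact: fh.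
Qed.

End plan_disintegration.

(** * Existence of an optimal plan density *)

Section optimal_plan_density.
Context dd (T : measurableType dd) (R : realType) (mu : probability T R).
Context (S : finType) (c : S -> T -> R).
Hypothesis mc : forall s, measurable_fun setT (c s).
Hypothesis c_ge0 : forall s x, (0 <= c s x)%R.
Implicit Types f g : S -> T -> R.

Let cost f := \int[mu]_x (\sum_s c s x * f s x)%:E.
(** The squared norm, and next the squared distance, in L^2 of [mu] with values in R^S. *)
Let energy f := \int[mu]_x (\sum_s f s x ^+ 2)%:E.
Let sqdist f g := \int[mu]_x (\sum_s (f s x - g s x) ^+ 2)%:E.
Let mid f g : S -> T -> R := fun s x => ((f s x + g s x) / 2)%R.

Let plan_density_le1 f s x : plan_density mu f -> (f s x <= 1)%R.
Proof.
move=> pf; rewrite -(plan_density_sum pf x) (bigD1 s)//= lerDl.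
by apply: sumr_ge0 => t _; exact: plan_density_ge0 pf _ _.
Qed.

Let measurable_cost f : (forall s, measurable_fun setT (f s)) ->
  measurable_fun setT (fun x => (\sum_s c s x * f s x)%:E).
Proof.
by move=> mf; apply/measurable_EFinP; apply: measurable_sum => s;
  exact: measurable_funM.
Qed.

Let measurable_energy f : (forall s, measurable_fun setT (f s)) ->
  measurable_fun setT (fun x => (\sum_s f s x ^+ 2)%:E).
Proof.
by move=> mf; apply/measurable_EFinP; apply: measurable_sum => s;
  exact: measurable_funX.
Qed.

Let measurable_sqdist f g : (forall s, measurable_fun setT (f s)) ->
  (forall s, measurable_fun setT (g s)) ->
  measurable_fun setT (fun x => (\sum_s (f s x - g s x) ^+ 2)%:E).
Proof.
move=> mf mg; apply: (measurable_energy (f := fun s x => (f s x - g s x)%R)).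
by move=> s; exact: measurable_funB.
Qed.

Let cost_integrand_ge0 f : (forall s x, (0 <= f s x)%R) ->
  forall x, 0 <= (\sum_s c s x * f s x)%:E.
Proof. by move=> f0 x; rewrite lee_fin sumr_ge0// => s _; rewrite mulr_ge0. Qed.

Let plan_density_mid f g : plan_density mu f -> plan_density mu g ->
  plan_density mu (mid f g).
Proof.
move=> pf pg; have [mf f0 f1 fI] := pf; have [mg g0 g1 gI] := pg.
split => [s|s x|x|s].
- by apply: measurable_funM => //; exact: measurable_funD.
- by rewrite divr_ge0// addr_ge0.
- by rewrite -mulr_suml big_split/= f1 g1 divff// pnatr_eq0.
- under eq_integral do rewrite /mid mulrC EFinM EFinD.
  rewrite ge0_integralZl_EFin//; last 2 first.
  + by move=> x _; rewrite adde_ge0// lee_fin.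
  + by apply: emeasurable_funD; exact/measurable_EFinP.
  rewrite ge0_integralD//; last 4 first.
  + by move=> x _; rewrite lee_fin.
  + exact/measurable_EFinP.
  + by move=> x _; rewrite lee_fin.
  + exact/measurable_EFinP.
  rewrite fI gI -EFinD -EFinM; congr (_%:E); lra.
Qed.

Let cost_mid f g : plan_density mu f -> plan_density mu g ->
  cost (mid f g) = (2^-1)%:E * (cost f + cost g).
Proof.
move=> [mf f0 _ _] [mg g0 _ _]; rewrite /cost.
rewrite -ge0_integralD//; [|by move=> x _; exact: cost_integrand_ge0
  |exact: measurable_cost|by move=> x _; exact: cost_integrand_ge0
  |exact: measurable_cost].
rewrite -ge0_integralZl_EFin//; last 2 first.
- by move=> x _; rewrite adde_ge0// cost_integrand_ge0.
- by apply: emeasurable_funD; exact: measurable_cost.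
apply: eq_integral => x _; rewrite -EFinD -EFinM -big_split/= mulr_sumr.
by congr (_%:E); apply: eq_bigr => s _; rewrite /mid; lra.
Qed.

Let energy_ge0 f : 0 <= energy f.
Proof.
by apply: integral_ge0 => x _; rewrite lee_fin sumr_ge0// => s _; rewrite sqr_ge0.
Qed.

Let energy_le1 f : plan_density mu f -> energy f <= 1.
Proof.
move=> pf; rewrite -(probability_setT mu) -(mul1e (mu setT)).
rewrite -integral_cst//; apply: ge0_le_integral => //.
- by move=> x _; rewrite lee_fin sumr_ge0// => s _; rewrite sqr_ge0.
- by apply: measurable_energy; exact: plan_density_measurable pf.
move=> x _; rewrite lee_fin -(plan_density_sum pf x); apply: ler_sum => s _.
rewrite expr2 ler_piMl ?plan_density_le1//; exact: plan_density_ge0 pf _ _.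
Qed.

Let energy_fin f : plan_density mu f -> energy f \is a fin_num.
Proof.
by move=> pf; rewrite ge0_fin_numE// (le_lt_trans (energy_le1 pf))// ltry.
Qed.

Let parallelogram f g : plan_density mu f -> plan_density mu g ->
  sqdist f g + 4%:E * energy (mid f g) = 2%:E * energy f + 2%:E * energy g.
Proof.
move=> pf pg; have [mf _ _ _] := pf; have [mg _ _ _] := pg.
have [mm _ _ _] := plan_density_mid pf pg.
have sq0 (h : S -> T -> R) x : 0 <= (\sum_s h s x ^+ 2)%:E.
  by rewrite lee_fin sumr_ge0// => s _; rewrite sqr_ge0.
rewrite /energy /sqdist.
rewrite -!ge0_integralZl_EFin//; do ?[by move=> x _; exact: sq0
  |exact: measurable_energy].
rewrite -!ge0_integralD//; do ?[by move=> x _; rewrite ?mule_ge0 ?sq0//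
  |by apply: emeasurable_funM => //; exact: measurable_energy
  |exact: measurable_sqdist].
  apply: eq_integral => x _; rewrite -!EFinM -!EFinD !mulr_sumr -!big_split/=.
  by congr (_%:E); apply: eq_bigr => s _; rewrite /mid; field.
by move=> x _; rewrite (sq0 (fun s x => f s x - g s x)%R).
Qed.

(* [J] is the limit, as [e] tends to 0, of the infimum [I e] of the energy over
   the convex set [K e]. The midpoint of two almost minimizers has energy almost
   at least [J], so the parallelogram identity makes them close. *)
Let minimizing_sequence (v : R) :
  (forall e : R, (0 < e)%R ->
    exists2 f, plan_density mu f & cost f <= (v + e)%:E) ->
  exists F : nat -> S -> T -> R, forall k,
    [/\ plan_density mu (F k), cost (F k) <= (v + 2 ^- k)%:E &
        sqdist (F k) (F k.+1) <= (4 ^- k)%:E].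
Proof.
move=> H.
pose K e f := plan_density mu f /\ cost f <= (v + e)%:E.
pose I e : R := inf [set fine (energy f) | f in K e].
have Ilb e : lbound [set fine (energy f) | f in K e] 0%R.
  by move=> _ [f _ <-]; rewrite fine_ge0.
have I0 e : (0 < e)%R -> [set fine (energy f) | f in K e] !=set0.
  by move=> /H[f pf fv]; exists (fine (energy f)), f.
have IleK e f : K e f -> (I e <= fine (energy f))%R.
  by move=> Kf; apply: ge_inf; [exists 0%R; exact: Ilb|exists f].
have KS e e' f : (e <= e')%R -> K e f -> K e' f.
  by move=> ee' [pf fv]; split=> //; rewrite (le_trans fv)// lee_fin lerD2l.
have Ile1 e : (0 < e)%R -> (I e <= 1)%R.
  move=> /H[f pf fv]; apply: (le_trans (IleK e f _)) => //.
  by rewrite -lee_fin fineK ?energy_fin// energy_le1.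
pose J : R := sup [set I e | e in [set e | (0 < e)%R]].
have hasJ : has_sup [set I e | e in [set e | (0 < e)%R]].
  split; first by exists (I 1%R), 1%R => //=.
  by exists 1%R => _ [e /= e0 <-]; exact: Ile1.
have near_min (eta : R) : (0 < eta)%R -> exists ef : R * (S -> T -> R),
    [/\ (0 < ef.1 <= eta)%R, K ef.1 ef.2, (fine (energy ef.2) < J + eta)%R &
        (J - eta < I ef.1)%R].
  move=> eta0; have [_ [e0 /= e00 <-] Je0] := sup_adherent eta0 hasJ.
  (* Shrinking the tolerance below [e0] can only increase the infimum [I], so it stays above
     [J - eta]; keeping it below [eta] controls the excess cost. *)
  pose e := Num.min e0 eta; have e_gt0 : (0 < e)%R by rewrite lt_min e00.
  have [_ [f Kf <-] fI] := inf_adherent eta0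
    (conj (I0 _ e_gt0) (ex_intro _ _ (Ilb e))).
  exists (e, f); split => //=.
  - by rewrite e_gt0/= ge_min lexx orbT.
  - rewrite (lt_le_trans fI)// lerD2r; apply: ub_le_sup; last by exists e.
    by case: hasJ.
  - rewrite (lt_le_trans Je0)//; apply: lb_le_inf; first exact: I0.
    move=> _ [g Kg <-]; apply: IleK; apply: KS Kg; by rewrite ge_min lexx.
(* The parallelogram identity will bound the squared distance by 2 (J + eta k) + 2 (J + eta (k+1)) -
   4 (J - eta k), which is at most 8 eta k. *)
pose eta k : R := (4 ^- k / 8)%R.
have eta_gt0 k : (0 < eta k)%R by rewrite divr_gt0// invr_gt0 exprn_gt0.
have /choice[G HG] : forall k, exists ef : R * (S -> T -> R),
    [/\ (0 < ef.1 <= eta k)%R, K ef.1 ef.2,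
        (fine (energy ef.2) < J + eta k)%R & (J - eta k < I ef.1)%R].
  by move=> k; exact: near_min.
exists (fun k => (G k).2) => k.
have [/andP[ek0 ek] [pk vk] Jk IJk] := HG k.
have [/andP[el0 el] [pl vl] Jl IJl] := HG k.+1.
split => //.
  apply: (le_trans vk); rewrite lee_fin lerD2l (le_trans ek)// /eta.
  rewrite ler_pdivrMr// (@le_trans _ _ (2 ^- k)%R)//.
    by rewrite lef_pV2 ?posrE ?exprn_gt0// lerXn2r ?nnegrE// ler_nat.
  by rewrite ler_peMr// ?invr_ge0 ?exprn_ge0// ler1n.
have pm := plan_density_mid pk pl.
have eta_le : (eta k.+1 <= eta k)%R.
  rewrite /eta ler_pM2r ?invr_gt0// lef_pV2 ?posrE ?exprn_gt0//.
  by rewrite ler_eXn2l// ltr1n.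
(* The midpoint obeys the larger of the two tolerances. The infimum of the energy there is one of
   the two infima already known to exceed [J - eta k]. *)
have Km : K (Num.max (G k).1 (G k.+1).1) (mid (G k).2 (G k.+1).2).
  split => //; rewrite cost_mid//.
  apply: (@le_trans _ _ ((2^-1)%:E * ((v + (G k).1)%:E + (v + (G k.+1).1)%:E))).
    by rewrite lee_pmul2l// ?leeD// lte_fin invr_gt0.
  rewrite -EFinD -EFinM lee_fin.
  have : ((G k).1 <= Num.max (G k).1 (G k.+1).1)%R by rewrite le_max lexx.
  have : ((G k.+1).1 <= Num.max (G k).1 (G k.+1).1)%R by rewrite le_max lexx orbT.
  set m := Num.max _ _; set a := (G k).1; set b := (G k.+1).1 => bm am.
  lra.
have mJ : (J - eta k < fine (energy (mid (G k).2 (G k.+1).2)))%R.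
  apply: lt_le_trans (IleK _ _ Km).
  by rewrite maxEle; case: ifP => _ //; apply: le_lt_trans IJl; rewrite lerD2l lerN2.
have := parallelogram pk pl.
rewrite -(fineK (energy_fin pk)) -(fineK (energy_fin pl)).
rewrite -(fineK (energy_fin pm)) -!EFinM -EFinD.
have : 0 <= sqdist (G k).2 (G k.+1).2.
  by apply: integral_ge0 => x _; rewrite lee_fin sumr_ge0// => s _; rewrite sqr_ge0.
case: sqdist => [r _ [] | |]//.
move=> E; rewrite lee_fin; have -> : (4 ^- k = 8 * eta k)%R.
  by rewrite /eta mulrC divfK// pnatr_eq0.
lra.
Qed.

(** Consecutive differences of the minimizing sequence are summable in L^1, so the sequence
    converges off a null set. Dominated convergence preserves the masses in the limit, and Fatou's
    lemma bounds its cost. *)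
Lemma plan_density_optimal (v : R) :
  (forall e : R, (0 < e)%R ->
    exists2 f, plan_density mu f & cost f <= (v + e)%:E) ->
  exists2 f, plan_density mu f & cost f <= v%:E.
Proof.
move=> /minimizing_sequence[F HF].
have pF k : plan_density mu (F k) by case: (HF k).
have mF k s : measurable_fun setT (F k s) by exact: plan_density_measurable (pF k) s.
have F0 k s x : (0 <= F k s x)%R by exact: plan_density_ge0 (pF k) s x.
pose u k x : R := (\sum_s `|F k.+1 s x - F k s x|)%R.
have u0 k x : (0 <= u k x)%R by rewrite sumr_ge0.
have mu_ k : measurable_fun setT (EFin \o u k).
  apply/measurable_EFinP; apply: measurable_sum => s.
  by apply: measurableT_comp => //; exact: measurable_funB.
(* Integrating the pointwise bound below with t = 2^k gives |S| 2^-k / 2 + 2^k 4^-k / 2, that is, C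
   2^-k. *)
pose C : R := ((#|S|%:R + 1) / 2)%R.
have intu k : \int[mu]_x (u k x)%:E <= (C * 2 ^- k)%:E.
  pose t : R := (2 ^+ k)%R.
  have t0 : (0 < t)%R by rewrite exprn_gt0.
  have tt : (4 ^- k = t^-1 * t^-1)%R.
    by rewrite -invfM -exprMn -natrM.
  apply: (@le_trans _ _ (\int[mu]_x ((#|S|%:R * t^-1 / 2)%:E +
      (t / 2)%:E * (\sum_s (F k s x - F k.+1 s x) ^+ 2)%:E))).
    apply: ge0_le_integral => //.
    - by move=> x _; rewrite lee_fin.
    - exact: mu_.
    - apply: emeasurable_funD => //; apply: emeasurable_funM => //.
      exact: measurable_sqdist.
    move=> x _; rewrite -EFinM -EFinD lee_fin mulr_sumr.
    have -> : (#|S|%:R * t^-1 / 2 = \sum_(s : S) t^-1 / 2 :> R)%R.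
      by rewrite sumr_const -[RHS]mulr_natl mulrA.
    rewrite -big_split/=; apply: ler_sum => s _; rewrite distrC.
    set z := (F k s x - F k.+1 s x)%R.
    (* AM-GM: [`|z| <= t^-1 / 2 + t / 2 * z ^+ 2] *)
    rewrite -(real_normK (num_real z)) -subr_ge0.
    have -> : (t^-1 / 2 + t / 2 * `|z| ^+ 2 - `|z| =
        t^-1 / 2 * (t * `|z| - 1) ^+ 2)%R.
      by field; rewrite lt0r_neq0.
    by rewrite mulr_ge0 ?sqr_ge0// divr_ge0// invr_ge0 ltW.
  rewrite ge0_integralD//; last 3 first.
  - by move=> x _; rewrite lee_fin divr_ge0// mulr_ge0// invr_ge0 ltW.
  - move=> x _; apply: mule_ge0; rewrite lee_fin.
      by rewrite divr_ge0// ltW.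
    by apply: sumr_ge0 => s _; exact: sqr_ge0.
  - by apply: emeasurable_funM => //; exact: measurable_sqdist.
  rewrite integral_cst// [X in _ * X]probability_setT mule1.
  rewrite ge0_integralZl_EFin//; last 3 first.
  - by move=> x _; rewrite lee_fin sumr_ge0// => s _; rewrite sqr_ge0.
  - exact: measurable_sqdist.
  - by rewrite divr_ge0// ltW.
  have [_ _ Dk] := HF k.
  apply: (@le_trans _ _ ((#|S|%:R / t / 2)%:E + (t / 2)%:E * (4 ^- k)%:E)).
    by rewrite leeD2l// lee_wpmul2l// lee_fin divr_ge0// ltW.
  rewrite -EFinM -EFinD lee_fin tt mulrA -[(t / 2 / t)%R]mulrA [(2^-1 / t)%R]mulrC.
  rewrite mulrA mulfV ?lt0r_neq0// mul1r /C -/t.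
  by rewrite le_eqVlt; apply/orP; left; apply/eqP; ring.
pose U x := \sum_(0 <= k <oo) (u k x)%:E.
have mU : measurable_fun setT U.
  apply: (@ge0_emeasurable_sum _ _ _ setT (fun k x => (u k x)%:E) xpredT) => //.
    by move=> k x _ _; rewrite lee_fin.
  by move=> k _; exact: mu_.
have U0 x : 0 <= U x by apply: nneseries_ge0 => k _ _; rewrite lee_fin.
have Ufin : {ae mu, forall x, U x \is a fin_num}.
  have : mu.-integrable setT U.
    apply/integrableP; split; first exact: mU.
    under eq_integral do rewrite gee0_abs//.
    rewrite integral_nneseries//; last by move=> k x _; rewrite lee_fin.
    apply: (@le_lt_trans _ _ (2 * C)%:E); last by rewrite ltry.
    apply: lime_le.
      by apply: is_cvg_nneseries => k _ _; apply: integral_ge0 => x _; rewrite lee_fin.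
    apply: nearW => n.
    (* The exact partial sum of the geometric series of the C 2^-k makes the induction go
       through. *)
    apply: (@le_trans _ _ (2 * C * (1 - 2 ^- n))%:E); last first.
      have C0 : (0 <= C)%R by rewrite divr_ge0// addr_ge0.
      have : (0 <= 2 * C * 2 ^- n)%R.
        by rewrite mulr_ge0 ?invr_ge0 ?exprn_ge0// mulr_ge0.
      by rewrite lee_fin mulrBr mulr1 gerBl.
    elim: n => [|n IH]; first by rewrite big_nil expr0 invr1 subrr mulr0.
    rewrite big_nat_recr//=; apply: (le_trans (leeD IH (intu n))).
    rewrite -EFinD lee_fin exprS invfM.
    by rewrite le_eqVlt; apply/orP; left; apply/eqP; field.
  by move=> /(integrable_ae measurableT); apply: filterS => x; exact.
(* Where the series of differences diverges, a null set, the sequence is frozen at its first term.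
   The limit then exists at every point and every term remains a partition of unity. *)
pose h k s x : R := if U x == +oo then F 0%N s x else F k s x.
have hF k s : ae_eq mu setT (EFin \o h k s) (EFin \o F k s).
  apply: filterS Ufin => x Ux _; rewrite /= /h.
  by case: eqP Ux => // ->.
have mh k s : measurable_fun setT (h k s).
  by apply: measurable_fun_ifT => //; exact: measurable_fun_eqe.
have h0 k s x : (0 <= h k s x)%R by rewrite /h; case: ifP.
have hk1 k s x : (h k s x <= 1)%R.
  by rewrite /h; case: ifP => _; exact: plan_density_le1.
have h1 k x : (\sum_s h k s x)%R = 1%R.
  by rewrite /h; case: (U x == +oo); exact: plan_density_sum.
have cvgh s x : cvgn (fun k => h k s x).
  rewrite /h; have [_|Ux] := eqVneq (U x) +oo; first exact: is_cvg_cst.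
  have {}Ux : U x \is a fin_num by rewrite ge0_fin_numE// lt_neqAle Ux leey.
  (* Telescoping turns the sequence into a series that converges absolutely, with partial sums of
     absolute values bounded by [U x]. *)
  rewrite (_ : (fun k => F k s x) = (fun k => F 0%N s x +
      series (telescope (fun k => F k s x)) k)%R); last first.
    by apply/funext => k; exact: eq_sum_telescope.
  apply: is_cvgD; first exact: is_cvg_cst.
  apply: normed_cvg; apply: nondecreasing_is_cvgn.
    apply: (@nondecreasing_series _
      (fun k => `|telescope (fun k => F k s x) k|%R) xpredT 0%N).
    by move=> k _ _; exact: normr_ge0.
  exists (fine (U x)) => _ [n _ <-].
  rewrite -lee_fin fineK//; apply: le_trans (nneseries_lim_ge n _); last first.
    by move=> k _ _; rewrite lee_fin.
  rewrite sumEFin lee_fin /series/=; apply: ler_sum => k _.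
  by rewrite /u (bigD1 s)//= lerDl sumr_ge0.
pose f s x : R := limn (fun k => h k s x).
have hf s x : h k s x @[k --> \oo] --> f s x by exact: cvgh.
have mf s : measurable_fun setT (f s).
  by apply: (measurable_fun_cvg (h := fun k => h k s)) => // x _; exact: hf.
have f0 s x : (0 <= f s x)%R by apply: limr_ge => //; exact: nearW.
exists f; first split => //.
- move=> x; apply: (@cvg_unique _ (@norm_hausdorff _ R) ((fun k => \sum_s h k s x)%R @ \oo)).
    by apply: cvg_big => [|s _]; [exact: add_continuous|exact: hf].
  rewrite (_ : (fun k => _) = cst 1%R); first exact: cvg_cst.
  by apply/funext => k; exact: h1.
- move=> s.
  have cI : \int[mu]_x (h k s x)%:E @[k --> \oo] --> \int[mu]_x (f s x)%:E.
    apply: (@dominated_cvg _ _ _ mu setT measurableT (fun k => EFin \o h k s)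
      (EFin \o f s) (cst 1)).
    + by move=> k; exact/measurable_EFinP.
    + by move=> x _; apply: cvg_EFin; [exact: nearW|exact: hf].
    + by [].
    + exact: finite_measure_integrable_cst.
    + by move=> k x _; rewrite /= lee_fin ger0_norm.
  apply: (cvg_unique _ cI) => //.
  rewrite (_ : (fun k => _) = cst (#|S|%:R^-1)%:E); first exact: cvg_cst.
  apply/funext => k; rewrite /= -(plan_density_mass (pF k) s).
  apply: ge0_ae_eq_integral => //; try exact/measurable_EFinP.
  + by move=> x _; rewrite lee_fin.
  + by move=> x _; rewrite lee_fin.
  + exact: hF.
pose q k x := (\sum_s c s x * h k s x)%:E.
have costh k : \int[mu]_x q k x <= (v + 2 ^- k)%:E.
  have [_ + _] := HF k; apply: le_trans.
  rewrite le_eqVlt; apply/orP; left; apply/eqP; apply: ge0_ae_eq_integral => //.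
  - exact: measurable_cost.
  - exact: measurable_cost.
  - by move=> x _; exact: cost_integrand_ge0.
  - by move=> x _; exact: cost_integrand_ge0.
  apply: filterS Ufin => x Ux _; rewrite /q /h.
  by case: eqP Ux => // ->.
have qlim x : q k x @[k --> \oo] --> (\sum_s c s x * f s x)%:E.
  apply: cvg_EFin; first exact: nearW.
  apply: cvg_big => [|s _]; first exact: add_continuous.
  by apply: cvgMr; exact: hf.
have -> : cost f = \int[mu]_x limn_einf (q ^~ x).
  by apply: eq_integral => x _; rewrite (cvg_limn_einf_sup (qlim x)).1.
apply: (@le_trans _ _ (limn_einf (fun k => \int[mu]_x q k x))).
  apply: fatou => // k; first exact: measurable_cost.
  by move=> x _; exact: cost_integrand_ge0.
rewrite limn_einf_lim; apply: lime_le; first exact: is_cvg_einfs.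
apply: nearW => n.
apply/lee_addgt0Pr => e e0.
(* An index beyond [n] with 2^-m at most [e] bounds the infimum of the tail; it exists because m <
   2^m. *)
have [m nm me] : exists2 m, (n <= m)%N & (2 ^- m <= e :> R)%R.
  have ei : (0 <= e^-1)%R by rewrite invr_ge0 ltW.
  exists (maxn n (Num.bound e^-1)); first exact: leq_maxl.
  rewrite -[leRHS]invrK lef_pV2 ?posrE ?invr_gt0 ?exprn_gt0//.
  apply: (le_trans (ltW (archi_boundP ei))); rewrite -natrX ler_nat.
  apply: (leq_trans _ (ltnW (ltn_expl _ _))) => //; exact: leq_maxr.
apply: (@le_trans _ _ (\int[mu]_x q m x)).
  by apply: ereal_inf_lbound; exists m.
by apply: (le_trans (costh m)); rewrite -EFinD lee_fin lerD2l.
Qed.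

End optimal_plan_density.

(** * Minkowski's inequality and integrals over products *)

(* The linear bound behind Minkowski's inequality: at [u = a] and [w = b] it is an
   equality, so integrating it replaces Hoelder's inequality. *)
Lemma powRD_le (R : realType) (p a b u w : R) :
  (1 <= p -> 0 < a -> 0 < b -> 0 <= u -> 0 <= w ->
  (u + w) `^ p <= (a + b) `^ p * (a / (a + b) / a `^ p) * u `^ p +
                  (a + b) `^ p * (b / (a + b) / b `^ p) * w `^ p)%R.
Proof.
move=> p1 a0 b0 u0 w0; have ab0 : (0 < a + b)%R by rewrite addr_gt0.
have t0 : (0 <= a / (a + b))%R by rewrite divr_ge0// ltW.
have t1 : (a / (a + b) <= 1)%R by rewrite ler_pdivrMr// mul1r lerDl ltW.
have tC : (1 - a / (a + b) = b / (a + b))%R by field; rewrite lt0r_neq0.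
(* Convexity of the p-th power is applied at u/a and w/b with weights a/(a+b) and b/(a+b); the
   convex combination is (u+w)/(a+b). *)
have := @convex_powR R p p1 (Itv01 t0 t1) (u / a)%R (w / b)%R.
rewrite !inE/= !in_itv/= !andbT !divr_ge0 ?(ltW a0) ?(ltW b0)// => /(_ isT isT).
rewrite [X in (X `^ _ <= _)%R -> _]convRE convRE /= /unstable.onem tC.
have -> : (a / (a + b) * (u / a) + b / (a + b) * (w / b) = (u + w) / (a + b))%R.
  by field; rewrite !lt0r_neq0.
have pV (x y : R) : (0 <= x -> 0 < y -> (x / y) `^ p = x `^ p / y `^ p)%R.
  move=> x0 y0; rewrite powRM ?invr_ge0 ?(ltW y0)//.
  by rewrite -[(y^-1)%R]powR_inv1 ?(ltW y0)// -powRrM mulN1r powRN.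
rewrite !pV ?addr_ge0// ler_pdivrMr ?powR_gt0// => /le_trans; apply.
rewrite le_eqVlt; apply/orP; left; apply/eqP; ring.
Qed.

(** Taking p-th roots reduces this to a comparison of real numbers up to [e]. It allows zero radii,
    by which [powRD_le] cannot divide, to be replaced by positive ones. *)
Lemma le_powR_addgt0 (R : realType) (p c : R) (L : \bar R) :
  (0 < p)%R -> (0 <= c)%R -> 0 <= L ->
  (forall e : R, (0 < e)%R -> L <= ((c + e) `^ p)%:E) -> L <= (c `^ p)%:E.
Proof.
move=> p0 c0; case: L => [r| |]//; last by move=> _ /(_ _ ltr01).
rewrite lee_fin => r0 H.
have rpK : ((r `^ p^-1) `^ p = r)%R by rewrite -powRrM mulVf ?gt_eqF// powRr1.
rewrite lee_fin -rpK ge0_ler_powR ?nnegrE ?powR_ge0 ?(ltW p0)//.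
apply/ler_addgt0Pr => e e0.
have := H e e0; rewrite lee_fin => re.
have ce : (0 <= c + e)%R by rewrite addr_ge0// ltW.
have := @ge0_ler_powR _ p^-1 _ r ((c + e) `^ p)%R.
rewrite invr_ge0 (ltW p0) !nnegrE powR_ge0 r0 => /(_ isT isT isT re).
by rewrite -powRrM mulfV ?gt_eqF// powRr1.
Qed.

Lemma integral_prod_mul d1 d2 (T1 : measurableType d1)
    (T2 : measurableType d2) (R : realType)
    (mu : probability T1 R) (nu : probability T2 R)
    (phi : T1 -> \bar R) (psi : T2 -> \bar R) :
  measurable_fun setT phi -> (forall x, 0 <= phi x) ->
  measurable_fun setT psi -> (forall y, 0 <= psi y) ->
  \int[mu \x nu]_z (phi z.1 * psi z.2) =
  \int[mu]_x phi x * \int[nu]_y psi y.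
Proof.
move=> mphi phi0 mpsi psi0; rewrite fubini_tonelli1//; last 2 first.
- by apply: emeasurable_funM; apply: measurableT_comp.
- by move=> z; rewrite mule_ge0.
rewrite -ge0_integralZr//; last exact: integral_ge0.
apply: eq_integral => x _; rewrite /fubini_F/=.
by rewrite ge0_integralZl.
Qed.

(** * Gluing two plans along a common finite uniform measure *)

Section glue_plans.
Context d1 d2 (T1 : measurableType d1) (T2 : measurableType d2)
  (R : realType) (mu : probability T1 R) (nu : probability T2 R)
  (S : finType) (f : S -> T1 -> R) (g : S -> T2 -> R).
Hypotheses (pf : plan_density mu f) (pg : plan_density nu g).

Let mf := plan_density_measurable pf.
Let mg := plan_density_measurable pg.
Let f0 := plan_density_ge0 pf.
Let g0 := plan_density_ge0 pg.

Let h (z : T1 * T2) : \bar R :=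
  \sum_s #|S|%:R%:E * ((f s z.1)%:E * (g s z.2)%:E).

Let fg_ge0 s (z : T1 * T2) : 0 <= (f s z.1)%:E * (g s z.2)%:E.
Proof. by rewrite mule_ge0// lee_fin. Qed.

Let h_term_ge0 s (z : T1 * T2) :
  0 <= #|S|%:R%:E * ((f s z.1)%:E * (g s z.2)%:E).
Proof. by rewrite mule_ge0// lee_fin. Qed.

Let h_ge0 z : 0 <= h z.
Proof. exact: sume_ge0. Qed.

Let m_h_term s : measurable_fun setT
  (fun z : T1 * T2 => #|S|%:R%:E * ((f s z.1)%:E * (g s z.2)%:E)).
Proof.
apply: emeasurable_funM => //; apply: emeasurable_funM.
- by apply/measurable_EFinP; apply: measurableT_comp.
- by apply/measurable_EFinP; apply: measurableT_comp.
Qed.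

Let mh : measurable_fun setT h.
Proof. exact: emeasurable_sum. Qed.

(** An empty sum could not equal 1 at [point]. *)
Let S_neq0 : (#|S|%:R != 0 :> R)%R.
Proof.
rewrite pnatr_eq0; apply/eqP => S0; have := plan_density_sum pf point.
rewrite big1 => [/eqP|s _]; first by rewrite eq_sym oner_eq0.
by have := fintype0 s S0.
Qed.

(** Each term is a product of a function of [z.1] and one of [z.2]. Integrating out the latter
    leaves |S| times the mass 1/|S| of [g s], hence 1. *)
Let integral_left (phi : S -> T1 -> \bar R) :
  (forall s, measurable_fun setT (phi s)) -> (forall s x, 0 <= phi s x) ->
  \int[mu \x nu]_z (\sum_s phi s z.1 * (#|S|%:R%:E * ((f s z.1)%:E * (g s z.2)%:E)))
  = \sum_s \int[mu]_x (phi s x * (f s x)%:E).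
Proof.
move=> mphi phi0; rewrite ge0_integral_sum//; last first.
- by move=> s z _; rewrite mule_ge0.
- by move=> s; apply: emeasurable_funM => //; apply: measurableT_comp.
apply: eq_bigr => s _.
transitivity (\int[mu \x nu]_z ((phi s z.1 * (f s z.1)%:E) *
    (#|S|%:R%:E * (g s z.2)%:E))).
  by apply: eq_integral => z _; rewrite [LHS]muleCA [RHS]muleCA !muleA.
rewrite (@integral_prod_mul _ _ _ _ _ mu nu (fun x => phi s x * (f s x)%:E)
  (fun y => #|S|%:R%:E * (g s y)%:E))//; last 4 first.
- by apply: emeasurable_funM => //; exact/measurable_EFinP.
- by move=> x; rewrite mule_ge0// lee_fin.
- by apply: emeasurable_funM => //; exact/measurable_EFinP.
- by move=> y; rewrite mule_ge0// lee_fin.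
rewrite ge0_integralZl_EFin//; last 2 first.
- by move=> y _; rewrite lee_fin.
- exact/measurable_EFinP.
by rewrite (plan_density_mass pg) -EFinM mulfV// mule1.
Qed.

Let integral_right (psi : S -> T2 -> \bar R) :
  (forall s, measurable_fun setT (psi s)) -> (forall s x, 0 <= psi s x) ->
  \int[mu \x nu]_z (\sum_s psi s z.2 * (#|S|%:R%:E * ((f s z.1)%:E * (g s z.2)%:E)))
  = \sum_s \int[nu]_y (psi s y * (g s y)%:E).
Proof.
move=> mpsi psi0; rewrite ge0_integral_sum//; last first.
- by move=> s z _; rewrite mule_ge0.
- by move=> s; apply: emeasurable_funM => //; apply: measurableT_comp.
apply: eq_bigr => s _.
transitivity (\int[mu \x nu]_z ((#|S|%:R%:E * (f s z.1)%:E) *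
    (psi s z.2 * (g s z.2)%:E))).
  by apply: eq_integral => z _; rewrite [RHS]muleCA !muleA.
rewrite (@integral_prod_mul _ _ _ _ _ mu nu (fun x => #|S|%:R%:E * (f s x)%:E)
  (fun y => psi s y * (g s y)%:E))//; last 4 first.
- by apply: emeasurable_funM => //; exact/measurable_EFinP.
- by move=> x; rewrite mule_ge0// lee_fin.
- by apply: emeasurable_funM => //; exact/measurable_EFinP.
- by move=> y; rewrite mule_ge0// lee_fin.
rewrite ge0_integralZl_EFin//; last 2 first.
- by move=> y _; rewrite lee_fin.
- exact/measurable_EFinP.
by rewrite (plan_density_mass pf) -EFinM mulfV// mul1e.
Qed.

Let integral_fst_h (phi : T1 -> \bar R) :
  measurable_fun setT phi -> (forall x, 0 <= phi x) ->
  \int[mu \x nu]_z (phi z.1 * h z) = \int[mu]_x phi x.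
Proof.
move=> mphi phi0.
under eq_integral do rewrite ge0_sume_distrr//.
rewrite (integral_left (phi := fun=> phi))//.
rewrite -ge0_integral_sum//; last first.
- by move=> s x _; rewrite mule_ge0// lee_fin.
- by move=> s; apply: emeasurable_funM => //; exact/measurable_EFinP.
apply: eq_integral => x _; rewrite -ge0_sume_distrr; last first.
  by move=> s _; rewrite lee_fin.
by rewrite sumEFin (plan_density_sum pf) mule1.
Qed.

Let integral_snd_h (psi : T2 -> \bar R) :
  measurable_fun setT psi -> (forall x, 0 <= psi x) ->
  \int[mu \x nu]_z (psi z.2 * h z) = \int[nu]_y psi y.
Proof.
move=> mpsi psi0.
under eq_integral do rewrite ge0_sume_distrr//.
rewrite (integral_right (psi := fun=> psi))//.
rewrite -ge0_integral_sum//; last first.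
- by move=> s x _; rewrite mule_ge0// lee_fin.
- by move=> s; apply: emeasurable_funM => //; exact/measurable_EFinP.
apply: eq_integral => x _; rewrite -ge0_sume_distrr; last first.
  by move=> s _; rewrite lee_fin.
by rewrite sumEFin (plan_density_sum pg) mule1.
Qed.

Let int_h : \int[mu \x nu]_z h z = 1.
Proof.
under eq_integral do rewrite -[h _]mul1e.
rewrite (integral_fst_h (phi := cst 1))// integral_cst//.
by rewrite mul1e [LHS]probability_setT.
Qed.

Definition glued_plan : probability (T1 * T2)%type R :=
  density_measure mh h_ge0 int_h.

Lemma glued_plan_coupling : coupling mu nu glued_plan.
Proof.
split => A mA; rewrite /pushforward.
- rewrite -[A in RHS]setIT -integral_indic// -integral_fst_h//; last exact/measurable_EFinP.
  rewrite [LHS]integral_mkcond; apply: eq_integral => z _.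
  by rewrite epatch_indic muleC.
- rewrite -[A in RHS]setIT -integral_indic// -integral_snd_h//; last exact/measurable_EFinP.
  rewrite [LHS]integral_mkcond; apply: eq_integral => z _.
  by rewrite epatch_indic muleC.
Qed.

(** The plan is a sum of pieces indexed by [s], and on each piece [powRD_le] bounds the cost
    linearly in the p-th powers of [u s] and [w s]. Each of these depends on one coordinate only, so
    its integral reduces to one of the two given costs. *)
Lemma glued_plan_powR_le (p : R) (u : S -> T1 -> R) (w : S -> T2 -> R)
    (D : T1 * T2 -> R) (a b : R) :
  (1 <= p)%R -> (0 <= a)%R -> (0 <= b)%R ->
  (forall s, measurable_fun setT (u s)) -> (forall s x, (0 <= u s x)%R) ->
  (forall s, measurable_fun setT (w s)) -> (forall s y, (0 <= w s y)%R) ->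
  measurable_fun setT D -> (forall z, (0 <= D z)%R) ->
  (forall s z, (D z <= u s z.1 + w s z.2)%R) ->
  \sum_s \int[mu]_x ((u s x `^ p)%:E * (f s x)%:E) <= (a `^ p)%:E ->
  \sum_s \int[nu]_y ((w s y `^ p)%:E * (g s y)%:E) <= (b `^ p)%:E ->
  \int[glued_plan]_z (D z `^ p)%:E <= ((a + b) `^ p)%:E.
Proof.
move=> p1 a0 b0 mu_ u0 mw w0 mD D0 Duw ua wb.
have p0 : (0 < p)%R by rewrite (lt_le_trans _ p1).
apply: le_powR_addgt0 => //.
- by rewrite addr_ge0.
- by apply: integral_ge0 => z _; rewrite lee_fin powR_ge0.
(* Both radii are enlarged by e/2 so that they become positive. *)
move=> e e0; pose a' := (a + e / 2)%R; pose b' := (b + e / 2)%R.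
have a'0 : (0 < a')%R by rewrite ltr_wpDl// divr_gt0.
have b'0 : (0 < b')%R by rewrite ltr_wpDl// divr_gt0.
have -> : (a + b + e = a' + b')%R by rewrite /a' /b'; lra.
pose A : R := ((a' + b') `^ p * (a' / (a' + b') / a' `^ p))%R.
pose B : R := ((a' + b') `^ p * (b' / (a' + b') / b' `^ p))%R.
have A0 : (0 <= A)%R.
  apply: mulr_ge0; first exact: powR_ge0.
  apply: divr_ge0; last exact: powR_ge0.
  by apply: divr_ge0; rewrite ltW// addr_gt0.
have B0 : (0 <= B)%R.
  apply: mulr_ge0; first exact: powR_ge0.
  apply: divr_ge0; last exact: powR_ge0.
  by apply: divr_ge0; rewrite ltW// addr_gt0.
have mpow d (T : measurableType d) (v : T -> R) :
    measurable_fun setT v -> measurable_fun setT (fun x => (v x `^ p)%:E).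
  move=> mv; apply/measurable_EFinP.
  exact: (measurableT_comp (measurable_powR p) mv).
pose phi s x := (A * u s x `^ p)%:E.
pose psi s y := (B * w s y `^ p)%:E.
have phi0 s x : 0 <= phi s x by rewrite lee_fin mulr_ge0 ?powR_ge0.
have psi0 s x : 0 <= psi s x by rewrite lee_fin mulr_ge0 ?powR_ge0.
have mphi s : measurable_fun setT (phi s).
  rewrite /phi; under eq_fun do rewrite EFinM.
  by apply: emeasurable_funM => //; exact: mpow.
have mpsi s : measurable_fun setT (psi s).
  rewrite /psi; under eq_fun do rewrite EFinM.
  by apply: emeasurable_funM => //; exact: mpow.
have mleft s : measurable_fun setT (fun z : T1 * T2 => phi s z.1 *
    (#|S|%:R%:E * ((f s z.1)%:E * (g s z.2)%:E))).
  by apply: emeasurable_funM => //; exact: (measurableT_comp (mphi s)).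
have mright s : measurable_fun setT (fun z : T1 * T2 => psi s z.2 *
    (#|S|%:R%:E * ((f s z.1)%:E * (g s z.2)%:E))).
  by apply: emeasurable_funM => //; exact: (measurableT_comp (mpsi s)).
rewrite integral_density//; last 2 first.
- exact: mpow.
- by move=> z; rewrite lee_fin powR_ge0.
apply: (@le_trans _ _ (\int[mu \x nu]_z
    ((\sum_s phi s z.1 * (#|S|%:R%:E * ((f s z.1)%:E * (g s z.2)%:E))) +
     (\sum_s psi s z.2 * (#|S|%:R%:E * ((f s z.1)%:E * (g s z.2)%:E)))))).
  apply: ge0_le_integral => //.
  - by move=> z _; rewrite mule_ge0// lee_fin powR_ge0.
  - by apply: emeasurable_funM => //; exact: mpow.
  - by apply: emeasurable_funD; exact: emeasurable_sum.
  move=> z _; rewrite ge0_sume_distrr// -big_split/=; apply: lee_sum => s _.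
  rewrite -ge0_muleDl//; apply: lee_wpmul2r => //.
  rewrite -EFinD lee_fin; apply: (@le_trans _ _ ((u s z.1 + w s z.2) `^ p)%R).
    by rewrite ge0_ler_powR ?nnegrE ?addr_ge0// ltW.
  exact: powRD_le.
rewrite ge0_integralD//; last 4 first.
- by move=> z _; apply: sume_ge0 => s _; rewrite mule_ge0.
- exact: emeasurable_sum.
- by move=> z _; apply: sume_ge0 => s _; rewrite mule_ge0.
- exact: emeasurable_sum.
rewrite integral_left// integral_right//.
have pull d (T : measurableType d) (m : probability T R) (v k : T -> R) (C : R) :
    measurable_fun setT v -> measurable_fun setT k -> (forall x, 0 <= k x)%R ->
    (0 <= C)%R ->
    \int[m]_x ((C * v x `^ p)%:E * (k x)%:E) =
    C%:E * \int[m]_x ((v x `^ p)%:E * (k x)%:E).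
  move=> mv mk k0 C0; rewrite -ge0_integralZl_EFin//.
  - by apply: eq_integral => x _; rewrite EFinM muleA.
  - by move=> x _; rewrite mule_ge0// lee_fin ?powR_ge0.
  - by apply: emeasurable_funM; [exact: mpow|exact/measurable_EFinP].
under eq_bigr do rewrite pull//.
under [X in _ + X]eq_bigr do rewrite pull//.
rewrite -!ge0_sume_distrr; last 2 first.
- by move=> s _; apply: integral_ge0 => x _; rewrite mule_ge0// lee_fin ?powR_ge0.
- by move=> s _; apply: integral_ge0 => x _; rewrite mule_ge0// lee_fin ?powR_ge0.
apply: (@le_trans _ _ (A%:E * (a' `^ p)%:E + B%:E * (b' `^ p)%:E)).
  apply: leeD; apply: lee_wpmul2l; rewrite ?lee_fin//.
  - apply: (le_trans ua); rewrite lee_fin ge0_ler_powR ?nnegrE ?(ltW p0)// ?ltW//.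
    by rewrite ltrDl divr_gt0.
  - apply: (le_trans wb); rewrite lee_fin ge0_ler_powR ?nnegrE ?(ltW p0)// ?ltW//.
    by rewrite ltrDl divr_gt0.
(* The bound [powRD_le] is an equality at u = a' and w = b'. *)
rewrite -!EFinM -EFinD lee_fin le_eqVlt; apply/orP; left; apply/eqP.
rewrite /A /B; field.
by rewrite !lt0r_neq0 ?powR_gt0// addr_gt0.
Qed.

End glue_plans.

(** * Measurability of norms and atoms of empirical distributions *)

Section norm_measurability.
Context (R : realType) (m : nat) (N : 'rV[R]_m -> R) (NN : is_norm N).

Lemma is_norm0 : N 0%R = 0%R.
Proof. by rewrite -(scale0r 0%R) (is_norm_homogeneous NN) normr0 mul0r. Qed.

Lemma is_normN x : N (- x)%R = N x.
Proof. by rewrite -scaleN1r (is_norm_homogeneous NN) normrN1 mul1r. Qed.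

Lemma is_normB x y : N (x - y)%R = N (y - x)%R.
Proof. by rewrite -is_normN opprB. Qed.

Lemma is_norm_ge0 x : (0 <= N x)%R.
Proof.
have := is_norm_triangle NN x (- x)%R.
by rewrite subrr is_norm0 is_normN => ?; lra.
Qed.

Lemma is_normB_trans x y z : (N (x - z) <= N (x - y) + N (y - z))%R.
Proof.
by rewrite (le_trans _ (is_norm_triangle NN _ _))// addrA subrK.
Qed.

Let C (x : 'rV[R]_m) : R := (\sum_j `|x ord0 j| * N (delta_mx ord0 j))%R.

Let norm_le_coords x : (N x <= C x)%R.
Proof.
rewrite {1}[x]row_sum_delta /C.
elim/big_ind2 : _ => [|u a v b ua vb|j _]; first by rewrite is_norm0.
- by rewrite (le_trans (is_norm_triangle NN _ _))// lerD.
- by rewrite (is_norm_homogeneous NN).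
Qed.

(** Expanding in the canonical basis gives [N x <= C x], so N x and N y differ by at most C (x - y),
    which tends to 0 with x - y. *)
Lemma is_norm_continuous : continuous N.
Proof.
move=> /= x.
have FFx : Filter (nbhs (x : 'rV[R]_m)) by exact: nbhs_filter.
have cvgC : C (x - y)%R @[y --> x] --> (0 : R)%R.
  rewrite [X in _ --> X](_ : _ =
      \sum_(j < m) `|x ord0 j - x ord0 j| * N (delta_mx ord0 j) :> R)%R; last first.
    by rewrite big1// => j _; rewrite subrr normr0 mul0r.
  apply: (@cvg_big _ _ _ _ xpredT add_continuous _ _ _ _ _ (nbhs_filter x)).
  move=> j _; apply: cvgMl; apply: cvg_norm; under eq_fun do rewrite !mxE.
  by apply: cvgB; [exact: cvg_cst|exact: coord_continuous].
apply: (@squeeze_cvgr _ _ _ _ (fun y => N x - C (x - y))%R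
  (fun y => N x + C (x - y))%R).
- apply: nearW => y; apply/andP; split.
    rewrite lerBlDl; apply: le_trans (lerD (norm_le_coords (x - y)%R) (lexx _)).
    by rewrite (le_trans _ (is_norm_triangle NN _ _))// subrK.
  rewrite -lerBlDl (le_trans _ (norm_le_coords _))// is_normB lerBlDl.
  by rewrite (le_trans _ (is_norm_triangle NN _ _))// addrC subrK.
- by rewrite -[X in _ --> X]subr0; apply: cvgB; [exact: cvg_cst|exact: cvgC].
- by rewrite -[X in _ --> X]addr0; apply: cvgD; [exact: cvg_cst|exact: cvgC].
Qed.

Lemma measurable_is_norm : measurable_fun [set: euclid R m] (N : euclid R m -> R).
Proof.
apply: (measurability _ (RGenOpens.measurableE R)) => //.
move=> _ [_ [a [b ->]] <-]; rewrite setTI; apply: sub_sigma_algebra.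
have /continuousP := is_norm_continuous; apply.
exact: interval_open.
Qed.

End norm_measurability.

Lemma measurable_is_normB (R : realType) m (N : 'rV[R]_m -> R)
    dd (T : measurableType dd) (f g : T -> euclid R m) :
  is_norm N -> measurable_fun setT f -> measurable_fun setT g ->
  measurable_fun setT (fun t => N ((f t : 'rV[R]_m) - g t)%R).
Proof.
move=> NN mf mg; apply: (measurableT_comp (measurable_is_norm NN)).
apply: measurable_euclidP => j.
rewrite (_ : (fun t => _) =
    (fun t => (f t : 'rV_m) ord0 j - (g t : 'rV_m) ord0 j)%R); last first.
  by apply/funext => t; rewrite !mxE.
apply: measurable_funB.
- exact: (measurableT_comp (measurable_euclid_coord j) mf).
- exact: (measurableT_comp (measurable_euclid_coord j) mg).
Qed.

Lemma closed_measurable_euclid (R : realType) m (A : set 'rV[R]_m) :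
  closed A -> measurable (A : set (euclid R m)).
Proof.
move=> cA; rewrite -[A]setCK; apply: measurableC; apply: sub_sigma_algebra.
exact: closed_openC.
Qed.

Lemma measurable_euclid_set1 (R : realType) m (y : euclid R m) :
  measurable [set y].
Proof.
rewrite [X in measurable X](_ : _ = \bigcap_(j in [set: 'I_m])
    ((fun x : 'rV[R]_m => x ord0 j) @^-1` [set (y : 'rV[R]_m) ord0 j])).
  apply: fin_bigcap_measurable => // j _.
  rewrite -[X in measurable X]setTI.
  exact: (measurable_euclid_coord j measurableT).
apply/seteqP; split => [x -> j _//|x /= xy].
by apply/rowP => j; exact: xy.
Qed.

Lemma uniform_atoms_empirical dd (T : measurableType dd) (R : realType)
    (N : nat) (x : 'I_N.+1 -> T) : uniform_atoms (empirical R x) x.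
Proof.
move=> i; rewrite empiricalE.
rewrite (eq_bigr (fun j => ((x j == x i)%:R)%:E)) => [|j _]; last first.
  rewrite diracE; congr (_%:R)%:E; congr nat_of_bool.
  by apply/idP/eqP => [/set_mem//|->]; exact/mem_set.
rewrite sumEFin -EFinM card_ord mulrC; congr (_ / _)%:E.
by rewrite -natr_sum -sum1_card [in RHS]big_mkcond.
Qed.

(** * Block vectors and product plans *)

Section product_blocks.
Context (R : realType) (n : nat) (d : 'I_n -> nat).
Local Notation D := (\sum_k d k)%N.

Lemma eq_block (x y : 'rV[R]_D) : (forall k, block x k = block y k) -> x = y.
Proof.
move=> xy; rewrite -(submxrowK x) -(submxrowK y).
by apply: eq_mxrow => k; exact: xy.
Qed.

Lemma block_mxrow (B : forall k, 'rV[R]_(d k)) k : block (\mxrow_j B j) k = B k.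
Proof. exact: mxrowK. Qed.

Lemma measurable_product_set (Xi : forall k, set 'rV[R]_(d k)) :
  (forall k, closed (Xi k)) -> measurable (product_set Xi).
Proof.
move=> cXi; have := @measurable_blocks R n d (enum 'I_n) Xi.
rewrite (_ : [set _ | _] = product_set Xi); last first.
  by apply/seteqP; split => x /= Xix k; [|move=> _]; apply: Xix; rewrite mem_enum.
by apply => k; exact: closed_measurable_euclid.
Qed.

End product_blocks.

Section product_plans.
Context (R : realType) (n : nat) (d : 'I_n -> nat).
Local Notation D := (\sum_k d k)%N.
Variable P : forall k, probability (euclid R (d k)) R.

(** Induction along the list of blocks: as it has no repetition, [set_block] leaves the remaining
    factors unchanged and Tonelli's theorem splits off one factor. *)
Lemma integral_product_prob (g : forall k, euclid R (d k) -> \bar R) :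
  (forall k, measurable_fun setT (g k)) -> (forall k x, 0 <= g k x) ->
  \int[product_prob P]_x (\prod_k g k (block x k)) =
  \prod_k \int[P k]_x g k x.
Proof.
move=> mg g0.
have nilE (x : euclid R D) : \prod_(k <- [::]) g k (block x k) = 1 by exact: big_nil.
have consE k s (x : euclid R D) : \prod_(j <- k :: s) g j (block x j) =
    g k (block x k) * \prod_(j <- s) g j (block x j) by exact: big_cons.
have mgb k : measurable_fun setT (fun x : euclid R D => g k (block x k)).
  exact: (measurableT_comp (mg k) (@measurable_block R n d k)).
have mblock s : measurable_fun setT
    (fun x : euclid R D => \prod_(k <- s) g k (block x k)).
  elim: s => [|k s IH]; first by rewrite (funext nilE).
  rewrite (funext (consE k s)); exact: emeasurable_funM (mgb k) IH.
have prod0 s (x : 'rV[R]_D) : 0 <= \prod_(k <- s) g k (block x k).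
  by apply: prode_ge0.
suff H s : uniq s ->
    \int[block_product P s]_x (\prod_(k <- s) g k (block x k)) =
    \prod_(k <- s) \int[P k]_x g k x.
  rewrite -[RHS]big_enum/= -H ?enum_uniq//.
  by apply: eq_integral => x _; rewrite big_enum.
elim: s => [_|k s IH /= /andP[ks us]].
  rewrite big_nil; under eq_integral do rewrite nilE.
  by rewrite integral_cst// mul1e [LHS]probability_setT.
rewrite big_cons -IH//.
rewrite (ge0_integral_pushforward (@measurable_set_block R n d k))//=.
rewrite preimage_setT -(integral_prod_mul (P k) (block_product P s) (mg k) (g0 k)
  (mblock s) (prod0 s)).
apply: eq_integral => -[y x] _ /=; rewrite consE block_set_block dfwithin.
congr (_ * _); apply: eq_big_seq => j js.
by rewrite block_set_block dfwithout//; apply: contraNneq ks => ->.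
Qed.

Lemma integral_product_prob_block k (g : euclid R (d k) -> \bar R) :
  measurable_fun setT g -> (forall x, 0 <= g x) ->
  \int[product_prob P]_x g (block x k) = \int[P k]_x g x.
Proof.
move=> mg g0.
(* All the factors other than the k-th are the constant 1. *)
pose G := dfwith (fun j (_ : euclid R (d j)) => 1 : \bar R) k g.
have GE j : j != k -> G j = cst 1 by move=> jk; rewrite /G dfwithout// eq_sym.
have Gk : G k = g by rewrite /G dfwithin.
have mG j : measurable_fun setT (G j).
  by have [->|/GE->//] := eqVneq j k; rewrite Gk.
have G0 j x : 0 <= G j x.
  by have [jk|/GE->//] := eqVneq j k; subst j; rewrite Gk.
have := integral_product_prob mG G0.
rewrite [in RHS](bigD1 k)//= [X in _ * X]big1 ?mule1 => [|j /GE->]; last first.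
  by rewrite integral_cst// mul1e [LHS]probability_setT.
rewrite Gk => <-; apply: eq_integral => x _.
by rewrite (bigD1 k)//= big1 ?mule1 ?Gk// => j /GE->.
Qed.

Context (N : nat) (f : forall k, 'I_N.+1 -> euclid R (d k) -> R).
Hypothesis pf : forall k, plan_density (P k) (@f k).

Definition product_density (s : {ffun 'I_n -> 'I_N.+1}) (x : euclid R D) : R :=
  (\prod_k f (s k) (block x k : euclid R (d k)))%R.

(** Distributivity turns the sum over [s] of products into the product over blocks of sums equal to
    1. The masses multiply by independence. *)
Lemma plan_density_product : plan_density (product_prob P) product_density.
Proof.
split => [s|s x|x|s].
- apply: measurable_prod => k _.
  exact: (measurableT_comp (plan_density_measurable (pf k) _) (@measurable_block R n d k)).
- by apply: prodr_ge0 => k _; exact: plan_density_ge0 (pf k) _ _.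
- rewrite -(bigA_distr_bigA (fun k i => f i (block x k : euclid R (d k))))/=.
  by apply: big1 => k _; exact: plan_density_sum (pf k) _.
- under eq_integral do rewrite -prodEFin.
  rewrite (integral_product_prob (g := fun k x => (f (s k) x)%:E))//; last 2 first.
  + by move=> k; apply/measurable_EFinP; exact: plan_density_measurable (pf k) _.
  + by move=> k x; rewrite lee_fin; exact: plan_density_ge0 (pf k) _ _.
  under eq_bigr do rewrite (plan_density_mass (pf _)).
  rewrite prodEFin card_ffun prodr_const !card_ord natrX exprVn//.
Qed.

(** Since the cost involves block [k] only, summing over the other entries of [s] collapses their
    factors to 1. This is why the product plan is optimal for all the blocks at once. *)
Lemma product_density_cost k (c : 'I_N.+1 -> euclid R (d k) -> R) :
  (forall i, measurable_fun setT (c i)) -> (forall i x, (0 <= c i x)%R) ->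
  \sum_(s : {ffun 'I_n -> 'I_N.+1}) \int[product_prob P]_x
    ((c (s k) (block x k))%:E * (product_density s x)%:E) =
  \int[P k]_x (\sum_i c i x * f i x)%:E.
Proof.
move=> mc c0; have [ms s0 _ _] := plan_density_product.
have mcb i : measurable_fun setT (fun x : euclid R D => c i (block x k)).
  exact: (measurableT_comp (mc i) (@measurable_block R n d k)).
rewrite -ge0_integral_sum//; last first.
- by move=> s x _; rewrite mule_ge0// lee_fin.
- by move=> s; apply: emeasurable_funM => //; exact/measurable_EFinP.
rewrite -(integral_product_prob_block (g := fun x => (\sum_i c i x * f i x)%:E)); last first.
- move=> x; rewrite lee_fin sumr_ge0// => i _; rewrite mulr_ge0//.
  exact: plan_density_ge0 (pf k) _ _.
- apply/measurable_EFinP; apply: measurable_sum => i; apply: measurable_funM => //.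
  exact: plan_density_measurable (pf k) _.
apply: eq_integral => x _.
under eq_bigr do rewrite -EFinM.
rewrite sumEFin; congr (_%:E).
(* Attaching the cost to the k-th factor keeps each summand a product over blocks, so that
   distributivity applies. *)
pose G j i : R := ((if j == k then c i (block x k) else 1) *
  f i (block x j : euclid R (d j)))%R.
transitivity (\prod_j \sum_i G j i)%R.
  rewrite bigA_distr_bigA/=; apply: eq_bigr => s _.
  rewrite /product_density big_split/= -big_mkcond/= big_pred1_eq//.
rewrite (bigD1 k)//= [X in (_ * X)%R]big1 ?mulr1 => [|j jk].
  by apply: eq_bigr => i _; rewrite /G eqxx.
rewrite -[RHS](plan_density_sum (pf j) (block x j)); apply: eq_bigr => i _.
by rewrite /G (negbTE jk) mul1r.
Qed.

End product_plans.

(** * The product empirical distribution as a uniform measure on a grid *)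

Section product_empirical_atoms.
Context (R : realType) (n : nat) (d : 'I_n -> nat) (N : nat).
Context (xi : 'I_N.+1 -> 'rV[R]_(\sum_k d k)).

Definition grid (s : {ffun 'I_n -> 'I_N.+1}) : euclid R (\sum_k d k) :=
  \mxrow_k block (xi (s k)) k.

(** A grid point is determined by its blocks, so its multiplicity is the product of the
    multiplicities of its blocks among the samples. *)
Lemma uniform_atoms_product_empirical :
  uniform_atoms (product_empirical xi) grid.
Proof.
move=> s; pose x k i : euclid R (d k) := block (xi i) k.
rewrite (_ : [set grid s] = [set z | forall k, [set x k (s k)] (block z k)]); last first.
  apply/seteqP; split => [_ -> k/=|z /= zs]; first exact: block_mxrow.
  by apply: eq_block => k; rewrite zs block_mxrow.
rewrite [LHS](product_probE _ (A := fun k => [set x k (s k)])); last first.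
  by move=> k; exact: measurable_euclid_set1.
rewrite (eq_bigr (fun k => (#|[pred i | x k i == x k (s k)]|%:R / N.+1%:R)%:E)); last first.
  by move=> k _; have := uniform_atoms_empirical R (x k) (s k); rewrite card_ord => <-.
rewrite prodEFin big_split/= prodr_const card_ffun !card_ord natrX exprVn.
congr (_ / _)%:E; rewrite -natr_prod; congr (_%:R)%R.
(* The product of multiplicities counts the index functions that match [s] block by block. *)
rewrite -[LHS](_ : #|family (fun k => [pred i | x k i == x k (s k)])| = _); last first.
  by rewrite card_family foldrE big_map big_enum.
apply: eq_card => t; rewrite !inE; apply/forallP/eqP => [ts|ts k].
  apply: eq_block => k; rewrite !block_mxrow.
  by have := ts k; rewrite inE => /eqP.
rewrite inE /x; apply/eqP.
by have := congr1 (fun z => block z k) ts; rewrite !block_mxrow.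
Qed.

Lemma product_empirical_on (Xi_ : forall k, set 'rV[R]_(d k)) :
  (forall k, closed (Xi_ k)) -> (forall i, product_set Xi_ (xi i)) ->
  product_empirical xi (product_set Xi_) = 1.
Proof.
move=> cXi xiXi; rewrite [LHS](product_probE _ (A := Xi_)); last by move=> k; exact: closed_measurable_euclid.
apply: big1 => k _; rewrite [LHS]empiricalE (eq_bigr (fun=> 1)); last first.
  by move=> i _; rewrite diracE mem_set//; exact: xiXi.
by rewrite sumEFin sumr_const card_ord -EFinM mulVf.
Qed.

End product_empirical_atoms.

(** * Optimal plans from an empirical distribution *)

Section semidiscrete_wasserstein.
Context (R : realType) (m : nat) (norm : 'rV[R]_m -> R)
  (norm_norm : is_norm norm) (p : R) (p1 : (1 <= p)%R).
Context (N : nat) (y : 'I_N.+1 -> euclid R m) (nu : probability (euclid R m) R).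
Hypothesis nu_moment : \int[nu]_x (norm x `^ p)%:E < +oo.

Let p_gt0 : (0 < p)%R. Proof. exact: lt_le_trans p1. Qed.

Let measurable_moment :
  measurable_fun setT (fun x : euclid R m => (norm x `^ p)%:E).
Proof.
apply/measurable_EFinP.
exact: (measurableT_comp (measurable_powR p) (measurable_is_norm norm_norm)).
Qed.

Let measurable_cost : measurable_fun setT
  (fun z : euclid R m * euclid R m =>
     (norm ((z.1 : 'rV[R]_m) - z.2)%R `^ p)%:E).
Proof.
apply/measurable_EFinP; apply: (measurableT_comp (measurable_powR p)).
exact: measurable_is_normB norm_norm measurable_fst measurable_snd.
Qed.

Let empirical_moment : \int[empirical R y]_x (norm x `^ p)%:E < +oo.
Proof.
rewrite [ltLHS]ge0_integral_mscale//; last first.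
  by move=> x _; rewrite lee_fin powR_ge0.
rewrite ge0_integral_measure_sum//; last first.
  by move=> x _; rewrite lee_fin powR_ge0.
under eq_bigr do rewrite integral_dirac// diracT mul1e.
by rewrite sumEFin -EFinM ltry.
Qed.

(** The independent coupling works, its cost being controlled by the two p-th moments. It makes the
    Wasserstein infimum finite, so that [fine] retains its value. *)
Lemma finite_cost_coupling :
  exists2 pi, coupling (empirical R y) nu pi &
    \int[pi]_z (norm ((z.1 : 'rV[R]_m) - z.2)%R `^ p)%:E < +oo.
Proof.
exists (empirical R y \x nu : probability _ R).
  split => A mA; rewrite /pushforward.
  - rewrite (_ : _ @^-1` A = A `*` setT); last first.
      by apply/seteqP; split => [z|z []].
    by rewrite [LHS]product_measure1E// [X in _ * X]probability_setT mule1.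
  - rewrite (_ : _ @^-1` A = setT `*` A); last first.
      by apply/seteqP; split => [z|z []].
    by rewrite [LHS]product_measure1E// [X in X * _]probability_setT mul1e.
(* This is 2^(p-1), the coefficient in [powRD_le] at a = b = 1. *)
pose K : R := ((1 + 1) `^ p * (1 / (1 + 1) / 1 `^ p))%R.
have K0 : (0 <= K)%R.
  by rewrite mulr_ge0 ?powR_ge0// divr_ge0 ?powR_ge0// divr_ge0.
pose moment (x : euclid R m) : \bar R := K%:E * (norm x `^ p)%:E.
have mom0 x : 0 <= moment x by rewrite mule_ge0// lee_fin ?powR_ge0.
have mmom : measurable_fun setT moment by exact: emeasurable_funM.
have int_mom (mu : probability (euclid R m) R) :
    \int[mu]_x (norm x `^ p)%:E < +oo -> \int[mu]_x moment x < +oo.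
  move=> mu_mom; rewrite ge0_integralZl_EFin//; last first.
    by move=> x _; rewrite lee_fin powR_ge0.
  by rewrite lte_mul_pinfty.
apply: (@le_lt_trans _ _ (\int[empirical R y \x nu]_z
    (moment z.1 * cst 1 z.2 + cst 1 z.1 * moment z.2))).
  apply: ge0_le_integral => //.
  - by move=> z _; rewrite lee_fin powR_ge0.
  - by apply: emeasurable_funD; apply: emeasurable_funM => //;
      exact: (measurableT_comp mmom).
  move=> z _; rewrite /= mule1 mul1e /moment -!EFinM -EFinD lee_fin.
  apply: (@le_trans _ _ ((norm z.1 + norm z.2) `^ p)%R); last first.
    by apply: powRD_le => //; exact: is_norm_ge0.
  rewrite ge0_ler_powR ?nnegrE ?addr_ge0 ?is_norm_ge0// ?(ltW p_gt0)//.
  rewrite -[norm z.2](is_normN norm_norm); exact: is_norm_triangle.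
rewrite ge0_integralD//; last 4 first.
- by move=> z _; rewrite mule_ge0.
- by apply: emeasurable_funM => //; exact: (measurableT_comp mmom).
- by move=> z _; rewrite mule_ge0.
- by apply: emeasurable_funM => //; exact: (measurableT_comp mmom).
rewrite (@integral_prod_mul _ _ _ _ _ (empirical R y) nu moment (cst 1))//.
rewrite (@integral_prod_mul _ _ _ _ _ (empirical R y) nu (cst 1) moment)//.
rewrite !integral_cst// [X in _ * (1 * X) + _]probability_setT.
rewrite [X in _ + (1 * X) * _]probability_setT !mul1e !mule1.
by apply: lte_add_pinfty; apply: int_mom.
Qed.

(** Couplings of almost minimal cost disintegrate into plan densities, to which
    [plan_density_optimal] applies. *)
Lemma wasserstein_attained : exists2 f, plan_density nu f &
  \int[nu]_x (\sum_i norm ((y i : 'rV[R]_m) - x)%R `^ p * f i x)%:E <=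
  (fine (wasserstein norm p (empirical R y) nu) `^ p)%:E.
Proof.
pose costs := [set \int[pi]_z (norm ((z.1 : 'rV[R]_m) - z.2)%R `^ p)%:E
  | pi in coupling (empirical R y) nu].
have costs_fin : ereal_inf costs \is a fin_num.
  rewrite ge0_fin_numE.
    have [pi cpi pi_fin] := finite_cost_coupling.
    by apply: le_lt_trans pi_fin; apply: ereal_inf_lbound; exists pi.
  apply: le_ereal_inf_tmp => _ [pi _ <-].
  by apply: integral_ge0 => z _; rewrite lee_fin powR_ge0.
have costs_ge0 : 0 <= ereal_inf costs.
  apply: le_ereal_inf_tmp => _ [pi _ <-].
  by apply: integral_ge0 => z _; rewrite lee_fin powR_ge0.
(* The p-th power of the distance is the infimum of the costs. *)
rewrite /wasserstein -/costs -(fineK costs_fin) poweR_EFin/=.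
rewrite -powRrM mulVf ?gt_eqF// powRr1 ?fine_ge0//.
apply: plan_density_optimal => [i|i x|e e0].
- apply: (measurableT_comp (measurable_powR p)).
  exact: measurable_is_normB norm_norm (measurable_cst _) (@measurable_id _ _ _).
- exact: powR_ge0.
have [_ [pi [pi1 pi2] <-] pi_e] := lb_ereal_inf_adherent e0 costs_fin.
have [|f pf fG] := @plan_disintegration _ _ _ _ _ _ R pi nu fst snd
  measurable_fst measurable_snd pi2 _ y ord0 (fun i => measurable_euclid_set1 (y i)).
  by move=> i; rewrite pi1; [exact: uniform_atoms_empirical|exact: measurable_euclid_set1].
exists f => //; rewrite EFinD fineK//; apply: le_trans (ltW pi_e).
have [mf f0 _ _] := pf.
pose G (z : euclid R m * euclid R m) : \bar R :=
  (norm ((z.1 : 'rV[R]_m) - z.2)%R `^ p)%:E.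
rewrite [leRHS](_ : _ = \int[pi]_z G (z.1, z.2)); last first.
  by apply: eq_integral => -[].
rewrite (fG G)//; last by move=> z; rewrite lee_fin powR_ge0.
rewrite -ge0_integral_sum//; last first.
- by move=> i x _; rewrite mule_ge0// lee_fin ?powR_ge0.
- move=> i; apply: emeasurable_funM; last exact/measurable_EFinP.
  exact: (measurableT_comp measurable_cost (measurable_pair1 (y i))).
rewrite le_eqVlt; apply/orP; left; apply/eqP; apply: eq_integral => x _.
by rewrite -sumEFin; apply: eq_bigr => i _; rewrite EFinM.
Qed.

End semidiscrete_wasserstein.

(** * Plans on the product set and the multi-transport hyperrectangle *)

(** The complement of [A x B] is a union of two sets that are null by the marginal conditions. *)
Lemma coupling_full d1 d2 (T1 : measurableType d1) (T2 : measurableType d2)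
    (R : realType) (Q : probability T1 R) (P : probability T2 R)
    (pi : probability (T1 * T2)%type R) (A : set T1) (B : set T2) :
  measurable A -> measurable B -> coupling Q P pi -> prob_on A Q ->
  prob_on B P -> prob_on (A `*` B) pi.
Proof.
move=> mA mB [piQ piP] QA PB.
have mAT : measurable (A `*` [set: T2]) by exact: measurableX.
have mTB : measurable ([set: T1] `*` B) by exact: measurableX.
have piA : pi (~` (A `*` setT)) = 0.
  rewrite probability_setC// (_ : A `*` setT = fst @^-1` A).
    by rewrite [X in 1 - X](piQ A mA) QA subee.
  by apply/seteqP; split => [z []|z].
have piB : pi (~` (setT `*` B)) = 0.
  rewrite probability_setC// (_ : setT `*` B = snd @^-1` B).
    by rewrite [X in 1 - X](piP B mB) PB subee.
  by apply/seteqP; split => [z []|z].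
have mAB : measurable (A `*` B) by exact: measurableX.
have mABC := measurableC mAB.
rewrite /prob_on/= -[A `*` B]setCK probability_setC//.
rewrite (_ : ~` (A `*` B) = ~` (A `*` setT) `|` ~` (setT `*` B)); last first.
  rewrite -setCI; congr (~` _).
  by apply/seteqP; split => [z [? ?]|z [[? ?] [? ?]]].
rewrite [X in 1 - X](measureU0 (measurableC mAT) (measurableC mTB) piB).
by rewrite [X in 1 - X]piA sube0.
Qed.

Lemma plan_density_same_measure dd (T : measurableType dd) (R : realType)
    (mu nu : probability T R) (S : finType) (f : S -> T -> R) :
  same_measure mu nu -> plan_density nu f -> plan_density mu f.
Proof.
move=> munu [mf f0 f1 fI]; split => // s; rewrite -(fI s).
by apply: eq_measure_integral => A mA _; exact: munu.
Qed.

Section hyperrectangle.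
Context (R : realType) (p : R) (p1 : (1 <= p)%R) (n : nat) (d : 'I_n -> nat).
Local Notation D := (\sum_k d k)%N.
Context (norm : forall k, 'rV[R]_(d k) -> R)
  (norm_norm : forall k, is_norm (norm k)).
Context (Xi_ : forall k, set 'rV[R]_(d k)) (Xi_closed : forall k, closed (Xi_ k)).

Let block_cost k (z : euclid R D * euclid R D) : R :=
  norm (block z.1 k - block z.2 k)%R.

Let block_cost_ge0 k z : (0 <= block_cost k z)%R.
Proof. exact: is_norm_ge0. Qed.

Let measurable_block_cost k : measurable_fun setT (block_cost k).
Proof.
apply: (measurable_is_normB (norm_norm k)).
- exact: (measurableT_comp (@measurable_block R n d k) measurable_fst).
- exact: (measurableT_comp (@measurable_block R n d k) measurable_snd).
Qed.

Let measurable_block_cost_powR k :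
  measurable_fun setT (fun z => (block_cost k z `^ p)%:E).
Proof.
apply/measurable_EFinP.
exact: (measurableT_comp (measurable_powR p) (measurable_block_cost k)).
Qed.

Let block_cost_powR_ge0 k z : 0 <= (block_cost k z `^ p)%:E.
Proof. by rewrite lee_fin powR_ge0. Qed.

Let mXi : measurable (product_set Xi_).
Proof. exact: measurable_product_set. Qed.

Let integral_block_cost (pi : probability (euclid R D * euclid R D)%type R) k :
  prob_on (product_set Xi_ `*` product_set Xi_) pi ->
  \int[pi]_(z in product_set Xi_ `*` product_set Xi_)
     (norm (block z.1 k - block z.2 k)%R `^ p)%:E =
  \int[pi]_z (block_cost k z `^ p)%:E.
Proof.
move=> piXi; apply: (integral_full_set (measurableX mXi mXi) piXi) => [|z].
- exact: measurable_block_cost_powR.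
- exact: block_cost_powR_ge0.
Qed.

(** One glued plan serves all blocks simultaneously: for each [k], the triangle inequality through
    the k-th block of the atom [y s] feeds Minkowski's inequality. *)
Lemma glued_hyperrectangle (S : finType) (y : S -> euclid R D)
    (Q P : probability (euclid R D) R) (f g : S -> euclid R D -> R)
    (eps eps' : 'I_n -> R) :
  (forall k, (0 <= eps k)%R) -> (forall k, (0 <= eps' k)%R) ->
  prob_on (product_set Xi_) Q -> prob_on (product_set Xi_) P ->
  plan_density Q f -> plan_density P g ->
  (forall k, \sum_s \int[Q]_x ((norm (block (y s) k - block x k)%R `^ p)%:E *
     (f s x)%:E) <= (eps' k `^ p)%:E) ->
  (forall k, \sum_s \int[P]_x ((norm (block (y s) k - block x k)%R `^ p)%:E *
     (g s x)%:E) <= (eps k `^ p)%:E) ->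
  transport_hyperrectangle norm p (product_set Xi_) Q
    (fun k => eps k + eps' k)%R P.
Proof.
move=> e0 e'0 QXi PXi pf pg Qcost Pcost.
have cQP := glued_plan_coupling pf pg.
have gXi := coupling_full mXi mXi cQP QXi PXi.
exists (glued_plan pf pg); split => //; [by case: cQP|by case: cQP|move=> k].
(* The left factor of the glued plan is [Q], whose radius is [eps' k]. *)
rewrite integral_block_cost// addrC.
have mnorm (s : S) : measurable_fun setT
    (fun x : euclid R D => norm (block (y s) k - block x k)%R).
  apply: (measurable_is_normB (norm_norm k)); first exact: measurable_cst.
  exact: (@measurable_block R n d k).
apply: (@glued_plan_powR_le _ _ _ _ _ _ _ _ _ _ pf pg p
  (fun s x => norm (block (y s) k - block x k)%R)
  (fun s x => norm (block (y s) k - block x k)%R)) => //.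
- by move=> s x; exact: is_norm_ge0.
- by move=> s x; exact: is_norm_ge0.
- move=> s z; rewrite /block_cost [X in (_ <= X + _)%R](is_normB (norm_norm k)).
  exact: is_normB_trans.
Qed.

(** This is meant for the plan that places [P] in the hyperrectangle around the product empirical
    distribution, its first marginal. *)
Lemma plan_density_of_coupling_fst (S : finType) (s0 : S) (y : S -> euclid R D)
    (Q P : probability (euclid R D) R)
    (pi : probability (euclid R D * euclid R D)%type R) (eps : 'I_n -> R) :
  uniform_atoms Q y -> coupling Q P pi ->
  prob_on (product_set Xi_ `*` product_set Xi_) pi ->
  (forall k, \int[pi]_(z in product_set Xi_ `*` product_set Xi_)
     (norm (block z.1 k - block z.2 k)%R `^ p)%:E <= (eps k `^ p)%:E) ->
  exists2 g, plan_density P g & forall k,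
    \sum_s \int[P]_x ((norm (block (y s) k - block x k)%R `^ p)%:E *
      (g s x)%:E) <= (eps k `^ p)%:E.
Proof.
move=> Qy [piQ piP] piXi cost.
have [|g pg gG] := @plan_disintegration _ _ _ _ _ _ R pi P fst snd
  measurable_fst measurable_snd piP _ y s0 (fun s => measurable_euclid_set1 (y s)).
  by move=> s; rewrite piQ; [exact: Qy|exact: measurable_euclid_set1].
exists g => // k; have := cost k; rewrite integral_block_cost//.
rewrite -(gG (fun z => (block_cost k z `^ p)%:E))//.
Qed.

(** This is meant for the plan of claim (i), whose second marginal is the product empirical
    distribution; symmetry of the norm exchanges the two points in the cost. *)
Lemma plan_density_of_coupling_snd (S : finType) (s0 : S) (y : S -> euclid R D)
    (Q P : probability (euclid R D) R)
    (pi : probability (euclid R D * euclid R D)%type R) (eps : 'I_n -> R) :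
  uniform_atoms Q y -> coupling P Q pi ->
  prob_on (product_set Xi_ `*` product_set Xi_) pi ->
  (forall k, \int[pi]_(z in product_set Xi_ `*` product_set Xi_)
     (norm (block z.1 k - block z.2 k)%R `^ p)%:E <= (eps k `^ p)%:E) ->
  exists2 g, plan_density P g & forall k,
    \sum_s \int[P]_x ((norm (block (y s) k - block x k)%R `^ p)%:E *
      (g s x)%:E) <= (eps k `^ p)%:E.
Proof.
move=> Qy [piP piQ] piXi cost.
have [|g pg gG] := @plan_disintegration _ _ _ _ _ _ R pi P snd fst
  measurable_snd measurable_fst piP _ y s0 (fun s => measurable_euclid_set1 (y s)).
  by move=> s; rewrite piQ; [exact: Qy|exact: measurable_euclid_set1].
exists g => // k; have := cost k; rewrite integral_block_cost//.
rewrite -(gG _ (measurable_block_cost_powR k) (block_cost_powR_ge0 k)).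
apply: le_trans; rewrite le_eqVlt; apply/orP; left; apply/eqP.
apply: eq_integral => z _; rewrite /block_cost/=.
by rewrite [in LHS](is_normB (norm_norm k)).
Qed.

End hyperrectangle.

(* Both claims by gluing along the grid *)
Local Close Scope ereal_scope.

Theorem proposition8p1 (R : realType) (p : R) (p1 : 1 <= p)
    (n : nat) (d : 'I_n -> nat)
    (norm : forall k, 'rV[R]_(d k) -> R)
    (norm_norm : forall k, is_norm (norm k))
    (Xi_ : forall k, set 'rV[R]_(d k)) (Xi_closed : forall k, closed (Xi_ k))
    (N : nat) (xi : 'I_N.+1 -> 'rV[R]_(\sum_k d k))
    (xi_in : forall i, product_set Xi_ (xi i))
    (P : probability (euclid R (\sum_k d k)) R)
    (P_on : prob_on (product_set Xi_) P)
    (eps : 'I_n -> R) (eps_ge0 : forall k, 0 <= eps k)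
    (P_in : transport_hyperrectangle norm p (product_set Xi_)
              (product_empirical xi) eps P)
    (Phat : probability (euclid R (\sum_k d k)) R)
    (Phat_on : prob_on (product_set Xi_) Phat) :
  (forall (pihat : probability
             (euclid R (\sum_k d k) * euclid R (\sum_k d k))%type R)
          (eps' : 'I_n -> R),
      coupling Phat (product_empirical xi) pihat ->
      (forall k, 0 <= eps' k) ->
      (forall k, (\int[pihat]_(z in product_set Xi_ `*` product_set Xi_)
                    (norm k (block z.1 k - block z.2 k) `^ p)%:E
                  <= (eps' k `^ p)%:E)%E) ->
      transport_hyperrectangle norm p (product_set Xi_)
        Phat (fun k => eps k + eps' k) P) /\
  (forall Phat_ : forall k, probability (euclid R (d k)) R,
      (forall k, prob_moment_on (norm k) p (Xi_ k) (Phat_ k)) ->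
      same_measure Phat (product_prob Phat_) ->
      transport_hyperrectangle norm p (product_set Xi_) Phat
        (fun k => eps k + fine (wasserstein (norm k) p
           (empirical R (fun i => block (xi i) k : euclid R (d k)))
           (Phat_ k))) P).
Proof.
set Q := product_empirical xi.
have QXi : prob_on (product_set Xi_) Q by exact: product_empirical_on.
have mXi : measurable (product_set Xi_ : set (euclid R (\sum_k d k))).
  exact: measurable_product_set.
have Qgrid := uniform_atoms_product_empirical xi.
pose s0 : {ffun 'I_n -> 'I_N.+1} := [ffun=> ord0].
have [pi [piXi piQ piP cost]] := P_in.
(* The densities on [P] are common to both claims, which differ only in the densities on [Phat]. *)
have [g pg gcost] := plan_density_of_coupling_fst norm_norm Xi_closed s0 Qgrid
  (conj piQ piP) piXi cost.
split => [pihat eps' cpihat eps'0 hatcost|Phat_ mom PhatE].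
  have hatXi := coupling_full mXi mXi cpihat Phat_on QXi.
  have [f pf fcost] := plan_density_of_coupling_snd norm_norm Xi_closed s0 Qgrid
    cpihat hatXi hatcost.
  exact: glued_hyperrectangle pf pg fcost gcost.
pose y k i : euclid R (d k) := block (xi i) k.
(* An exactly optimal plan is chosen for each marginal, since the radius of claim (ii) is the
   distance itself. *)
have opt k := cid2 (wasserstein_attained (norm_norm k) p1 (y k) (mom k).2).
pose f_ k := projT1 (opt k).
have pf_ k : plan_density (Phat_ k) (f_ k) by rewrite /f_; case: (opt k).
have f_cost k : (\int[Phat_ k]_x
    (\sum_i norm k (y k i - x) `^ p * f_ k i x)%:E <=
    (fine (wasserstein (norm k) p (empirical R (y k)) (Phat_ k)) `^ p)%:E)%E.
  by rewrite /f_; case: (opt k).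
(* [Phat] agrees with the product measure on measurable sets, which suffices to transfer
   integrals. *)
have pf := plan_density_same_measure PhatE (plan_density_product pf_).
apply: (glued_hyperrectangle (y := grid xi) p1 norm_norm Xi_closed _ _ _ _ pf pg) => //.
  by move=> k; rewrite fine_ge0// poweR_ge0.
move=> k; apply: le_trans (f_cost k).
pose c i x := norm k (y k i - x) `^ p.
rewrite -(product_density_cost pf_ (c := c))//; last first.
  by move=> i x; exact: powR_ge0.
  move=> i; apply: (measurableT_comp (measurable_powR p)).
  exact: (measurable_is_normB (norm_norm k) (measurable_cst _) (@measurable_id _ _ _)).
rewrite le_eqVlt; apply/orP; left; apply/eqP; apply: eq_bigr => s _.
(* The k-th block of [grid xi s] is the k-th block of the sample of index [s k]. *)
rewrite /c /y -(block_mxrow (fun k => block (xi (s k)) k)).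
by apply: eq_measure_integral => A mA _; exact: PhatE.
Qed.
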